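(* Let $f(z)=z+\sum_{k=2}^\infty b_kz^k\in\mathscr{S}^*_\wp$. Then $|b_2|\le1$, $|b_3|\le1$, $|b_4|\le 5/6$ and $|b_5|\le5/8$. The bounds are sharp, with equality for $f_1(z)=z\exp(e^z-1)=z+z^2+z^3+\frac56z^4+\frac58z^5+\cdots$.
   Context: $\mathbb{D}$ is the unit disk; $\mathcal{A}$ is the class of analytic $f$ on $\mathbb{D}$ with $f(0)=0,f'(0)=1$. $f\prec g$ means $f=g\circ\omega$ for analytic $\omega:\mathbb{D}\to\mathbb{D}$, $\omega(0)=0$. $\wp(z)=1+ze^z$, $\mathscr{S}^*_\wp=\{f\in\mathcal{A}:zf'(z)/f(z)\prec\wp(z)\}$. *)

(* Defs.v *)
From Stdlib Require Import Reals ClassicalEpsilon.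
From Coquelicot Require Import Coquelicot.
Open Scope C_scope.

Definition inD (z : C) : Prop := (Cmod z < 1)%R.

Definition cexp (z : C) : C :=
  (exp (Re z) * cos (Im z), exp (Re z) * sin (Im z))%R.

Definition analytic_on_D (f : C -> C) : Prop :=
  forall z, inD z -> @ex_derive C_AbsRing C_NormedModule f z.

Definition Cderiv (f : C -> C) (z : C) : C :=
  epsilon (inhabits (0 : C))
    (fun l => @is_derive C_AbsRing C_NormedModule f z l).

Definition classA (f : C -> C) : Prop :=
  analytic_on_D f /\ f 0 = 0 /\ @is_derive C_AbsRing C_NormedModule f (0:C) (1:C).

Definition subordinate (f g : C -> C) : Prop :=
  exists w : C -> C, analytic_on_D w /\ w 0 = 0 /\
    (forall z, inD z -> inD (w z)) /\
    (forall z, inD z -> f z = g (w z)).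

Definition wp (z : C) : C := 1 + z * cexp z.

(* z f'(z) / f(z), with its removable value 1 at z = 0. *)
Definition logderiv (f : C -> C) (z : C) : C :=
  if Ceq_dec z 0 then 1 else z * Cderiv f z / f z.

(* S*_℘ = { f ∈ A : z f'(z)/f(z) ≺ ℘(z) }; the quotient is required to be
   defined, i.e. f(z) ≠ 0 for z ∈ D \ {0}. *)
Definition Sstar_wp (f : C -> C) : Prop :=
  classA f /\ (forall z, inD z -> z <> 0 -> f z <> 0) /\
  subordinate (logderiv f) wp.

(* Main.v *)
Require Import Defs.
From Stdlib Require Import Reals Factorial Wf_nat Lra Lia Classical ClassicalEpsilon.
From Coquelicot Require Import Coquelicot.
Open Scope C_scope.

(** Write z f'/f = 1 + w e^w with w(z) = c1 z + c2 z^2 + ... a Schwarz function. Then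
    b2 = c1, 2 b3 = c2 + 2 c1^2, 3 b4 = c3 + 7/2 c1 c2 + 5/2 c1^3 and
    4 b5 = c4 + 10/3 c1 c3 + 3/2 c2^2 + 37/6 c1^2 c2 + 5/2 c1^4.
    For |eta| = 1 the function u = eta w / (1 - eta w) has Re u > -1/2, so its Taylor
    coefficients are at most 1 in modulus. The functionals of w above are combinations of these
    coefficients over several eta, times unimodular factors (and, for b5, of c1 times such a
    coefficient), whose positive weights add up exactly to the bound.

    For the bound on the coefficients of u, average u over the rotations by n-th roots of unity
    and apply the Schwarz lemma to q / (1 + q). Its maximum principle only needs second-order
    expansions of w at each point; these come from f being a power series, by inverting
    w e^w = z f'/f - 1, so no integral formula enters.

    The extremal function has the power series of the solution of F' = e^z F. *)

(** * Expansions up to O(|h|^n) *)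

(** Each bound is the value of its functional at w(z) = z, where only the power of c1 survives: it
    is the coefficient of c1^n. Replacing w by eta w multiplies a monomial of degree k in the c's by
    eta^k, so the coefficient of index n of u, times zeta^n with zeta = 1/eta, carries zeta^(n - k).
    Bounding a functional thus means finding a positive measure on the unit circle with prescribed
    moments, whose total mass is the coefficient of c1^n. For b5 the coefficients of c1 c3 and c2^2
    are not in the ratio 2 : 1 that every such average has; the product of c1 with a third
    coefficient repairs this. The origin needs separate care: f vanishes there, so the quotient z
    f'/f gives no expansion of w. Hence second-order expansions are asked only off 0, the maximum
    principle lives on a punctured disk, and the coefficients of w at 0 come from the equation
    cleared of denominators. *)

Lemma Cmod_minus_ge (x y : C) : (Cmod x - Cmod y <= Cmod (x - y))%R.
Proof.
  assert (H := Cmod_triangle (x - y) y).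
  replace (x - y + y) with x in H by ring. lra.
Qed.

Lemma Cmod_plus_ge (x y : C) : (Cmod x - Cmod y <= Cmod (x + y))%R.
Proof.
  rewrite <- (Cmod_opp y). replace (x + y) with (x - - y) by ring.
  apply Cmod_minus_ge.
Qed.

(** The increment h = 0 is included, so for n > 0 such a function vanishes at 0. Where a quotient
    degenerates at 0, its value there has to be handled separately. *)
Definition bigO (n : nat) (g : C -> C) : Prop :=
  exists K d : R, (0 < d)%R /\
    forall h : C, (Cmod h < d)%R -> (Cmod (g h) <= K * Cmod h ^ n)%R.

Lemma bigO_intro (n : nat) (g : C -> C) (K d : R) :
  (0 < d)%R ->
  (forall h : C, (Cmod h < d)%R -> (Cmod (g h) <= K * Cmod h ^ n)%R) ->
  bigO n g.
Proof. intros; exists K, d; auto. Qed.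

(** Normalised constants: K > 0 can be divided by, and d <= 1 makes higher powers of |h| smaller. *)
Lemma bigO_elim (n : nat) (g : C -> C) :
  bigO n g ->
  exists K d : R, (0 < K)%R /\ (0 < d <= 1)%R /\
    forall h : C, (Cmod h < d)%R -> (Cmod (g h) <= K * Cmod h ^ n)%R.
Proof.
  intros (K & d & Hd & H).
  exists (Rmax K 1), (Rmin d 1). split; [|split].
  - apply Rlt_le_trans with 1%R; [lra | apply Rmax_r].
  - split; [apply Rmin_glb_lt; lra | apply Rmin_r].
  - intros h Hh. apply Rle_trans with (K * Cmod h ^ n)%R.
    + apply H. apply Rlt_le_trans with (1 := Hh). apply Rmin_l.
    + apply Rmult_le_compat_r; [apply pow_le, Cmod_ge_0 | apply Rmax_l].
Qed.

Lemma bigO_ext_loc (n : nat) (f g : C -> C) (d : R) :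
  (0 < d)%R -> (forall h, (Cmod h < d)%R -> f h = g h) -> bigO n f -> bigO n g.
Proof.
  intros Hd E Hf. destruct (bigO_elim _ _ Hf) as (K & d' & HK & Hd' & H).
  apply bigO_intro with K (Rmin d d').
  - apply Rmin_glb_lt; lra.
  - intros h Hh. rewrite <- E.
    + apply H. apply Rlt_le_trans with (1 := Hh). apply Rmin_r.
    + apply Rlt_le_trans with (1 := Hh). apply Rmin_l.
Qed.

Lemma bigO_ext (n : nat) (f g : C -> C) :
  (forall h, f h = g h) -> bigO n f -> bigO n g.
Proof. intros E; apply bigO_ext_loc with 1%R; [lra | auto]. Qed.

Lemma bigO_plus (n : nat) (f g : C -> C) :
  bigO n f -> bigO n g -> bigO n (fun h => f h + g h).
Proof.
  intros Hf Hg.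
  destruct (bigO_elim _ _ Hf) as (K & d & HK & Hd & H).
  destruct (bigO_elim _ _ Hg) as (K' & d' & HK' & Hd' & H').
  apply bigO_intro with (K + K')%R (Rmin d d'). { apply Rmin_glb_lt; lra. }
  intros h Hh.
  assert (H1 := H h (Rlt_le_trans _ _ _ Hh (Rmin_l _ _))).
  assert (H2 := H' h (Rlt_le_trans _ _ _ Hh (Rmin_r _ _))).
  assert (H3 := Cmod_triangle (f h) (g h)). lra.
Qed.

Lemma bigO_mult (n m : nat) (f g : C -> C) :
  bigO n f -> bigO m g -> bigO (n + m) (fun h => f h * g h).
Proof.
  intros Hf Hg.
  destruct (bigO_elim _ _ Hf) as (K & d & HK & Hd & H).
  destruct (bigO_elim _ _ Hg) as (K' & d' & HK' & Hd' & H').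
  apply bigO_intro with (K * K')%R (Rmin d d'). { apply Rmin_glb_lt; lra. }
  intros h Hh.
  assert (H1 := H h (Rlt_le_trans _ _ _ Hh (Rmin_l _ _))).
  assert (H2 := H' h (Rlt_le_trans _ _ _ Hh (Rmin_r _ _))).
  rewrite Cmod_mult, pow_add.
  replace (K * K' * (Cmod h ^ n * Cmod h ^ m))%R
    with ((K * Cmod h ^ n) * (K' * Cmod h ^ m))%R by ring.
  apply Rmult_le_compat; auto using Cmod_ge_0.
Qed.

Lemma bigO_le (n m : nat) (f : C -> C) : (m <= n)%nat -> bigO n f -> bigO m f.
Proof.
  intros Hnm Hf. destruct (bigO_elim _ _ Hf) as (K & d & HK & Hd & H).
  apply bigO_intro with K d; [lra|]. intros h Hh.
  apply Rle_trans with (1 := H h Hh). apply Rmult_le_compat_l; [lra|].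
  assert (H0 := Cmod_ge_0 h).
  replace n with (m + (n - m))%nat by lia. rewrite pow_add.
  rewrite <- (Rmult_1_r (Cmod h ^ m)) at 2.
  apply Rmult_le_compat_l; [apply pow_le; auto|].
  rewrite <- (pow1 (n - m)). apply pow_incr. lra.
Qed.

Lemma bigO_const (c : C) : bigO 0 (fun _ => c).
Proof. apply bigO_intro with (Cmod c) 1%R; [lra|]. intros; simpl; lra. Qed.

Lemma bigO_zero (n : nat) : bigO n (fun _ => 0).
Proof. apply bigO_intro with 0%R 1%R; [lra|]. intros; rewrite Cmod_0; lra. Qed.

Lemma bigO_id : bigO 1 (fun h => h).
Proof. apply bigO_intro with 1%R 1%R; [lra|]. intros; simpl; lra. Qed.

Lemma bigO_pow_id (n : nat) : bigO n (fun h => h ^ n).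
Proof.
  apply bigO_intro with 1%R 1%R; [lra|]. intros. rewrite Cmod_pow. lra.
Qed.

Lemma bigO_scal (n : nat) (c : C) (f : C -> C) :
  bigO n f -> bigO n (fun h => c * f h).
Proof. intros H. apply (bigO_mult 0 n); auto using bigO_const. Qed.

Lemma bigO_opp (n : nat) (f : C -> C) : bigO n f -> bigO n (fun h => - f h).
Proof.
  intros H. apply bigO_ext with (fun h => (- (1)) * f h); [intro; ring|].
  apply bigO_scal; auto.
Qed.

Lemma bigO_minus (n : nat) (f g : C -> C) :
  bigO n f -> bigO n g -> bigO n (fun h => f h - g h).
Proof. intros; apply bigO_plus; auto using bigO_opp. Qed.

(** With m > 0 the inner function tends to 0 and so enters the neighbourhood on which the estimate
    of f holds. *)
Lemma bigO_comp (n m : nat) (f u : C -> C) :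
  (0 < m)%nat -> bigO n f -> bigO m u -> bigO (m * n) (fun h => f (u h)).
Proof.
  intros Hm Hf Hu. assert (Hu1 := bigO_le _ 1 _ Hm Hu).
  destruct (bigO_elim _ _ Hf) as (K & d & HK & Hd & H).
  destruct (bigO_elim _ _ Hu) as (K' & d' & HK' & Hd' & H').
  destruct (bigO_elim _ _ Hu1) as (L & e & HL & He & H1).
  apply bigO_intro with (K * K' ^ n)%R (Rmin (Rmin d' e) (d / L)).
  { repeat apply Rmin_glb_lt; try lra. apply Rdiv_lt_0_compat; lra. }
  intros h Hh.
  assert (A1 : (Cmod h < d')%R) by (apply Rlt_le_trans with (1 := Hh);
    eapply Rle_trans; [apply Rmin_l | apply Rmin_l]).
  assert (A2 : (Cmod h < e)%R) by (apply Rlt_le_trans with (1 := Hh);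
    eapply Rle_trans; [apply Rmin_l | apply Rmin_r]).
  assert (A3 : (Cmod h < d / L)%R) by (apply Rlt_le_trans with (1 := Hh);
    apply Rmin_r).
  specialize (H' h A1). specialize (H1 h A2). simpl in H1.
  assert (A4 : (L * Cmod h < d)%R).
  { apply Rmult_lt_compat_l with (r := L) in A3; [|lra].
    replace (L * (d / L))%R with d in A3 by (field; lra). lra. }
  apply Rle_trans with (K * Cmod (u h) ^ n)%R; [apply H; lra|].
  rewrite Rmult_assoc, pow_mult, <- Rpow_mult_distr.
  apply Rmult_le_compat_l; [lra|]. apply pow_incr.
  split; [apply Cmod_ge_0 | auto].
Qed.

Lemma bigO_small (n : nat) (f : C -> C) (e : R) :
  (0 < n)%nat -> bigO n f -> (0 < e)%R ->
  exists d, (0 < d)%R /\ forall h, (Cmod h < d)%R -> (Cmod (f h) < e)%R.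
Proof.
  intros Hn Hf He. apply bigO_le with (m := 1%nat) in Hf; [|lia].
  destruct (bigO_elim _ _ Hf) as (K & d & HK & Hd & H).
  exists (Rmin d (e / K)). split.
  { apply Rmin_glb_lt; [lra | apply Rdiv_lt_0_compat; lra]. }
  intros h Hh. assert (H1 := H h (Rlt_le_trans _ _ _ Hh (Rmin_l _ _))).
  assert (A3 := Rlt_le_trans _ _ _ Hh (Rmin_r _ _)).
  apply Rmult_lt_compat_l with (r := K) in A3; [|lra].
  replace (K * (e / K))%R with e in A3 by (field; lra). simpl in H1. lra.
Qed.

Lemma bigO_at_zero (n : nat) (f : C -> C) : (0 < n)%nat -> bigO n f -> f 0 = 0.
Proof.
  intros Hn (K & d & Hd & H). apply Cmod_eq_0.
  specialize (H 0). rewrite Cmod_0, pow_ne_zero in H by lia.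
  assert (H1 := Cmod_ge_0 (f 0)). lra.
Qed.

(** Near 0 the factor k + B h has modulus at least |k|/2. Inverses of jets and both determinations
    of w (off 0 and at 0) end with this division. *)
Lemma bigO_cancel (n : nat) (k : C) (A B : C -> C) :
  k <> 0 -> bigO 1 B -> bigO n (fun h => A h * (k + B h)) -> bigO n A.
Proof.
  intros Hk HB HA. apply Cmod_gt_0 in Hk.
  destruct (bigO_small _ _ (Cmod k / 2) (Nat.lt_0_1) HB) as (e & He & HB'); [lra|].
  destruct (bigO_elim _ _ HA) as (K & d & HK & Hd & H).
  apply bigO_intro with (K * (2 / Cmod k))%R (Rmin e d).
  { apply Rmin_glb_lt; lra. }
  intros h Hh.
  assert (H1 := H h (Rlt_le_trans _ _ _ Hh (Rmin_r _ _))).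
  assert (H2 := HB' h (Rlt_le_trans _ _ _ Hh (Rmin_l _ _))).
  assert (H3 := Cmod_plus_ge k (B h)).
  rewrite Cmod_mult in H1.
  apply Rmult_le_reg_r with (Cmod k / 2)%R; [lra|].
  replace (K * (2 / Cmod k) * Cmod h ^ n * (Cmod k / 2))%R
    with (K * Cmod h ^ n)%R by (field; lra).
  apply Rle_trans with (2 := H1). apply Rmult_le_compat_l; [apply Cmod_ge_0|]. lra.
Qed.

Lemma bigO_inv (k : C) (B : C -> C) :
  k <> 0 -> bigO 1 B -> bigO 0 (fun h => / (k + B h)).
Proof.
  intros Hk HB.
  apply bigO_cancel with k B; auto.
  assert (Hk' := Hk). apply Cmod_gt_0 in Hk'.
  destruct (bigO_small _ _ (Cmod k) (Nat.lt_0_1) HB) as (e & He & HB'); [lra|].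
  apply bigO_ext_loc with (fun _ => 1) e; auto using bigO_const.
  intros h Hh. field. intro E. specialize (HB' h Hh).
  assert (H3 := Cmod_plus_ge k (B h)). rewrite E, Cmod_0 in H3. lra.
Qed.

(** Stronger than complex differentiability: the remainder is O(h^2), as for power series. Product
    and chain rules then follow from the calculus of [bigO] alone. *)
Definition der (g : C -> C) (z l : C) : Prop :=
  bigO 2 (fun h => g (z + h) - g z - l * h).

(** An expansion at the single point z, with no regularity asked around it; this is all that the
    four-point average in the maximum principle consumes. *)
Definition jet2 (g : C -> C) (z : C) : Prop :=
  exists A B D : C, bigO 3 (fun h => g (z + h) - (A + B * h + D * h ^ 2)).

(** * Calculus of second-order jets *)

Lemma jet2_const (c z : C) : jet2 (fun _ => c) z.
Proof.
  exists c, 0, 0. apply bigO_ext with (fun _ => 0); [intro; ring | apply bigO_zero].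
Qed.

Lemma jet2_id (z : C) : jet2 (fun x => x) z.
Proof.
  exists z, 1, 0. apply bigO_ext with (fun _ => 0); [intro; ring | apply bigO_zero].
Qed.

Lemma jet2_plus (f g : C -> C) (z : C) :
  jet2 f z -> jet2 g z -> jet2 (fun x => f x + g x) z.
Proof.
  intros (A & B & D & H) (A' & B' & D' & H').
  exists (A + A'), (B + B'), (D + D').
  eapply bigO_ext; [|apply (bigO_plus _ _ _ H H')]. intro; simpl; ring.
Qed.

Lemma bigO_poly2 (A B D : C) : bigO 0 (fun h => A + B * h + D * h ^ 2).
Proof.
  repeat apply bigO_plus; auto using bigO_const; apply bigO_scal.
  - apply bigO_le with 1%nat; [lia | apply bigO_id].
  - apply bigO_le with 2%nat; [lia | apply bigO_pow_id].
Qed.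

Lemma bigO_jet2 (g : C -> C) (z A B D : C) :
  bigO 3 (fun h => g (z + h) - (A + B * h + D * h ^ 2)) ->
  A = g z /\ bigO 2 (fun h => g (z + h) - g z - B * h)
  /\ bigO 1 (fun h => g (z + h) - g z).
Proof.
  intros H. assert (E : A = g z).
  { apply bigO_at_zero in H; [|lia]. simpl in H.
    replace (z + 0) with z in H by ring.
    replace A with (g z - (g z - (A + B * 0 + D * (0 * (0 * 1))))) by ring.
    rewrite H. ring. }
  subst A. split; auto.
  assert (H2 : bigO 2 (fun h => g (z + h) - g z - B * h)).
  { eapply bigO_ext with (fun h => (g (z + h) - (g z + B * h + D * h ^ 2)) + D * h ^ 2).
    { intro; ring. }
    apply bigO_plus; [apply bigO_le with 3%nat; auto |].
    apply bigO_scal, bigO_pow_id. }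
  split; auto.
  eapply bigO_ext with (fun h => (g (z + h) - g z - B * h) + B * h).
  { intro; ring. }
  apply bigO_plus; [apply bigO_le with 2%nat; auto |].
  apply bigO_scal, bigO_id.
Qed.

Lemma jet2_bigO1 (g : C -> C) (z : C) :
  jet2 g z -> bigO 1 (fun h => g (z + h) - g z).
Proof. intros (A & B & D & H). apply (bigO_jet2 _ _ _ _ _ H). Qed.

Lemma jet2_bounded (g : C -> C) (z : C) :
  jet2 g z -> bigO 0 (fun h => g (z + h)).
Proof.
  intros H. apply jet2_bigO1 in H.
  apply bigO_ext with (fun h => g z + (g (z + h) - g z)); [intro; ring|].
  apply bigO_plus; [apply bigO_const | apply bigO_le with 1%nat; auto].
Qed.

Lemma jet2_mult (f g : C -> C) (z : C) :
  jet2 f z -> jet2 g z -> jet2 (fun x => f x * g x) z.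
Proof.
  intros Hf Hg. assert (Bf := jet2_bounded _ _ Hf).
  destruct Hf as (A & B & D & H), Hg as (A' & B' & D' & H').
  exists (A * A'), (A * B' + B * A'), (A * D' + B * B' + D * A').
  apply bigO_ext with (fun h =>
    f (z + h) * (g (z + h) - (A' + B' * h + D' * h ^ 2)) +
    (A' + B' * h + D' * h ^ 2) * (f (z + h) - (A + B * h + D * h ^ 2)) +
    (B * D' + D * B' + D * D' * h) * h ^ 3).
  { intro; ring. }
  apply bigO_plus; [apply bigO_plus|].
  - apply (bigO_mult 0 3); auto.
  - apply (bigO_mult 0 3); auto using bigO_poly2.
  - apply (bigO_mult 0 3); [|apply bigO_pow_id].
    apply bigO_plus; [apply bigO_const|].
    apply bigO_scal. apply bigO_le with 1%nat; auto using bigO_id.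
Qed.

Lemma jet2_inv (f : C -> C) (z : C) : f z <> 0 -> jet2 f z -> jet2 (fun x => / f x) z.
Proof.
  intros Hz (A & B & D & H). destruct (bigO_jet2 _ _ _ _ _ H) as (-> & _ & H1).
  (* Coefficients of the formal inverse of f z + B h + D h^2 up to degree two. Multiplying the
     remainder by f (z + h) leaves only terms of order three. *)
  set (a := / f z). set (b := - B * a ^ 2). set (d := (B ^ 2 * a - D) * a ^ 2).
  exists a, b, d.
  apply bigO_cancel with (f z) (fun h => f (z + h) - f z); auto.
  assert (Hz' := Hz). apply Cmod_gt_0 in Hz'.
  destruct (bigO_small _ _ (Cmod (f z)) (Nat.lt_0_1) H1) as (e & He & HB'); [lra|].
  apply bigO_ext_loc with (fun h =>
    - ((a + b * h + d * h ^ 2) * (f (z + h) - (f z + B * h + D * h ^ 2)))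
    - (B * d + D * b + D * d * h) * h ^ 3) e; auto.
  { intros h Hh. specialize (HB' h Hh).
    assert (Hn : f (z + h) <> 0).
    { intro E. rewrite E in HB'. replace (0 - f z) with (- f z) in HB' by ring.
      rewrite Cmod_opp in HB'. lra. }
    unfold d, b, a. field. auto. }
  apply bigO_minus.
  - apply bigO_opp. apply (bigO_mult 0 3); auto using bigO_poly2.
  - apply (bigO_mult 0 3); [|apply bigO_pow_id].
    apply bigO_plus; [apply bigO_const|].
    apply bigO_scal. apply bigO_le with 1%nat; auto using bigO_id.
Qed.

Lemma jet2_scal (c : C) (f : C -> C) (z : C) : jet2 f z -> jet2 (fun x => c * f x) z.
Proof. intros; apply jet2_mult; auto using jet2_const. Qed.

Lemma jet2_div (f g : C -> C) (z : C) :
  g z <> 0 -> jet2 f z -> jet2 g z -> jet2 (fun x => f x / g x) z.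
Proof. intros; apply jet2_mult; auto using jet2_inv. Qed.

Lemma jet2_pow (f : C -> C) (z : C) (n : nat) : jet2 f z -> jet2 (fun x => f x ^ n) z.
Proof.
  intros H; induction n as [|n IH]; simpl; auto using jet2_const, jet2_mult.
Qed.

Lemma jet2_ext_loc (f g : C -> C) (z : C) (d : R) :
  (0 < d)%R -> (forall h, (Cmod h < d)%R -> f (z + h) = g (z + h)) -> jet2 f z -> jet2 g z.
Proof.
  intros Hd E (A & B & D & H). exists A, B, D.
  eapply bigO_ext_loc; [exact Hd | | exact H].
  intros h Hh; simpl; rewrite E; auto.
Qed.

Lemma jet2_dilate (f : C -> C) (c z : C) : jet2 f (c * z) -> jet2 (fun x => f (c * x)) z.
Proof.
  intros (A & B & D & H). exists A, (B * c), (D * c ^ 2).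
  assert (Hc : bigO 1 (fun h => c * h)) by auto using bigO_scal, bigO_id.
  assert (H' := bigO_comp 3 1 _ _ Nat.lt_0_1 H Hc).
  eapply bigO_ext; [|exact H']. intro h; simpl.
  replace (c * (z + h)) with (c * z + c * h) by ring. ring.
Qed.

(** * The maximum principle *)

Lemma Cmod_le_abs (z : C) : (Cmod z <= Rabs (Re z) + Rabs (Im z))%R.
Proof.
  assert (H0 := Rabs_pos (Re z)). assert (H1 := Rabs_pos (Im z)).
  apply Rsqr_incr_0_var; [|lra].
  unfold Rsqr. replace (Cmod z * Cmod z)%R with (Cmod z ^ 2)%R by ring.
  rewrite Cmod2_alt, <- (pow2_abs (Re z)), <- (pow2_abs (Im z)).
  nra.
Qed.

Lemma im_le_Cmod (z : C) : (Rabs (Im z) <= Cmod z)%R.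
Proof.
  apply Rle_trans with (2 := Rmax_Cmod z). apply Rmax_r.
Qed.

(** Compactness of the closed disk, taken from that of the square [-r, r]^2: points outside the disk
    get a radius too small to reach any point of it. *)
Lemma disk_uniform (r : R) (P : R -> C -> Prop) :
  (forall d d' q, (d <= d')%R -> P d' q -> P d q) ->
  (forall p, (Cmod p <= r)%R -> exists d, (0 < d)%R /\
     forall q, (Cmod q <= r)%R -> (Cmod (q - p) < d)%R -> P d q) ->
  exists d, (0 < d)%R /\ forall q, (Cmod q <= r)%R -> P d q.
Proof.
  intros Hmon Hloc.
  (* The factor 2 absorbs the change of norm: the compactness result bounds the two coordinates of q
     - p by d separately. *)
  assert (Hloc' : forall p : C, exists d : posreal,
    forall q, (Cmod q <= r)%R -> (Cmod (q - p) < 2 * d)%R -> P d q).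
  { intros p. destruct (Rle_lt_dec (Cmod p) r) as [Hp | Hp].
    - destruct (Hloc p Hp) as (d & Hd & H).
      assert (Hd2 : (0 < d / 2)%R) by lra.
      exists (mkposreal _ Hd2). simpl. intros q Hq Hqp.
      apply Hmon with d; [lra|]. apply H; auto. lra.
    - assert (Hd2 : (0 < (Cmod p - r) / 2)%R) by lra.
      exists (mkposreal _ Hd2). simpl. intros q Hq Hqp. exfalso.
      assert (H := Cmod_minus_ge p q).
      replace (p - q) with (- (q - p)) in H by ring. rewrite Cmod_opp in H. lra. }
  set (delta := fun u v : R => proj1_sig (constructive_indefinite_description _ (Hloc' (u, v)))).
  destruct (compactness_value_2d (- r) r (- r) r delta) as [d Hd].
  exists d. split; [apply cond_pos|]. intros q Hq.
  apply NNPP; intro Hn.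
  assert (H1 := re_le_Cmod q). assert (H2 := im_le_Cmod q).
  apply Rabs_le_between in H1. apply Rabs_le_between in H2.
  apply (Hd (Re q) (Im q)); [lra | lra |].
  intros (u & v & _ & _ & Hu & Hv & Hduv). apply Hn.
  apply Hmon with (1 := Hduv).
  unfold delta in *. destruct (constructive_indefinite_description _ (Hloc' (u, v))) as [e He].
  simpl in *. apply He; auto.
  apply Rle_lt_trans with (1 := Cmod_le_abs _). destruct q as [x y].
  unfold Re, Im in *. simpl in *. unfold Rminus in *. lra.
Qed.

(** The hypothesis is upper semicontinuity. Compactness is used twice: to bound phi, and, if the
    supremum M were not attained, to get a uniform gap e below M. *)
Lemma disk_attains_max (phi : C -> R) (r : R) :
  (0 <= r)%R ->
  (forall p, (Cmod p <= r)%R -> forall m, (phi p < m)%R -> exists d, (0 < d)%R /\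
     forall q, (Cmod q <= r)%R -> (Cmod (q - p) < d)%R -> (phi q < m)%R) ->
  exists p, (Cmod p <= r)%R /\ forall q, (Cmod q <= r)%R -> (phi q <= phi p)%R.
Proof.
  intros Hr Husc.
  (* The bound phi q <= 1/d, written without division and with trivial cases added so that it is
     inherited by smaller d. *)
  destruct (disk_uniform r (fun d q => (phi q * d <= 1)%R \/ (d <= 0)%R \/ (phi q <= 0)%R))
    as (d & Hd & Hb).
  { intros d d' q Hdd [H | [H | H]]; [|right; left; lra | right; right; lra].
    destruct (Rle_lt_dec (phi q) 0); [right; right; auto|].
    left. apply Rle_trans with (2 := H). apply Rmult_le_compat_l; lra. }
  { intros p Hp. destruct (Husc p Hp (Rabs (phi p) + 1)%R) as (d & Hd & H).
    { assert (H := Rle_abs (phi p)). lra. }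
    assert (Hpos := Rabs_pos (phi p)).
    exists (Rmin d (/ (Rabs (phi p) + 1))). split.
    { apply Rmin_glb_lt; auto. apply Rinv_0_lt_compat; lra. }
    intros q Hq Hqp. destruct (Rle_lt_dec (phi q) 0); [right; right; auto|]. left.
    apply Rle_trans with ((Rabs (phi p) + 1) * / (Rabs (phi p) + 1))%R.
    - apply Rmult_le_compat; try lra.
      + apply Rmin_glb; [lra|]. apply Rlt_le, Rinv_0_lt_compat; lra.
      + apply Rlt_le, H; auto. apply Rlt_le_trans with (1 := Hqp), Rmin_l.
      + apply Rmin_r.
    - rewrite Rinv_r; lra. }
  destruct (completeness (fun y => exists q, (Cmod q <= r)%R /\ y = phi q)) as [M [HM1 HM2]].
  { exists (/ d)%R. intros y (q & Hq & ->).
    assert (Hdi := Rinv_0_lt_compat _ Hd).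
    destruct (Hb q Hq) as [H | [H | H]]; try lra.
    apply Rmult_le_reg_r with d; auto. rewrite Rinv_l; lra. }
  { exists (phi 0), 0. rewrite Cmod_0. auto. }
  apply NNPP; intro Hn.
  assert (Hlt : forall p, (Cmod p <= r)%R -> (phi p < M)%R).
  { intros p Hp. destruct (HM1 (phi p)) as [H | H]; eauto.
    exfalso. apply Hn. exists p; split; auto. intros q Hq. rewrite H. apply HM1; eauto. }
  destruct (disk_uniform r (fun d q => (phi q <= M - d)%R)) as (e & He & Hbe).
  { intros; lra. }
  { intros p Hp. assert (H := Hlt p Hp).
    destruct (Husc p Hp ((phi p + M) / 2)%R) as (e & He & H'); [lra|].
    exists (Rmin e ((M - phi p) / 2)). split; [apply Rmin_glb_lt; lra|].
    intros q Hq Hqp.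
    assert (H1 := H' q Hq (Rlt_le_trans _ _ _ Hqp (Rmin_l _ _))).
    assert (H2 := Rmin_r e ((M - phi p) / 2)). lra. }
  assert (H : (M <= M - e)%R); [|lra].
  apply HM2. intros y (q & Hq & ->). auto.
Qed.

(** The cross terms of the squared modulus are proportional to h, h^2 or their conjugates, whose
    sums over h = t, -t, it, -it vanish. *)
Lemma four_point_sum (A B D : C) (t : R) :
  let X h := (Cmod (A + B * h + D * h ^ 2) ^ 2)%R in
  (X (RtoC t) + X (- RtoC t)%C + X (Ci * t)%C + X (- (Ci * t))%C
   = 4 * Cmod A ^ 2 + 4 * Cmod B ^ 2 * t ^ 2 + 4 * Cmod D ^ 2 * t ^ 4)%R.
Proof.
  cbv zeta. rewrite !Cmod2_alt.
  destruct A as [a1 a2], B as [b1 b2], D as [d1 d2].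
  unfold Re, Im; simpl. ring.
Qed.

Lemma four_point_abs (p : C) (t : R) :
  let X h := (Cmod (p + h) ^ 2)%R in
  (X (RtoC t) + X (- RtoC t)%C + X (Ci * t)%C + X (- (Ci * t))%C
   = 4 * Cmod p ^ 2 + 4 * t ^ 2)%R.
Proof.
  cbv zeta. rewrite !Cmod2_alt. destruct p as [a1 a2].
  unfold Re, Im; simpl. ring.
Qed.

(* |G|^2 + e |z|^2 is strictly subharmonic: averaging over p + h, p - h, p + ih, p - ih
   cancels every term of order at most two except |B|^2 |h|^2 + e |h|^2. *)
Lemma no_local_max (G : C -> C) (p : C) (e d : R) :
  jet2 G p -> (0 < e)%R -> (0 < d)%R ->
  exists q, (Cmod (q - p) < d)%R /\
    (Cmod (G p) ^ 2 + e * Cmod p ^ 2 < Cmod (G q) ^ 2 + e * Cmod q ^ 2)%R.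
Proof.
  intros (A & B & D & H) He Hd. apply NNPP; intro Hn.
  assert (Hall : forall h, (Cmod h < d)%R ->
    (Cmod (G (p + h)%C) ^ 2 + e * Cmod (p + h) ^ 2 <= Cmod (G p) ^ 2 + e * Cmod p ^ 2)%R).
  { intros h Hh. apply Rnot_lt_le. intro Hlt. apply Hn. exists (p + h). split; auto.
    replace (p + h - p) with h by ring. auto. }
  destruct (bigO_jet2 _ _ _ _ _ H) as (-> & _).
  destruct (bigO_elim _ _ H) as (K & d' & HK & Hd' & HR).
  set (L := (Cmod (G p) + Cmod B + Cmod D)%R).
  assert (HL : (0 <= L)%R) by (unfold L; repeat apply Rplus_le_le_0_compat; apply Cmod_ge_0).
  assert (HLK : (0 <= L * K)%R) by (apply Rmult_le_pos; lra).
  (* At distance t the remainder changes |G|^2 by at most 2 L K t^3; this t makes that less than the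
     gain e t^2. The 1 keeps the denominator positive. *)
  set (t := (Rmin (Rmin d d') (e / (2 * L * K + 1)) / 2)%R).
  assert (Ht0 : (0 < t)%R).
  { unfold t. apply Rdiv_lt_0_compat; [|lra]. repeat apply Rmin_glb_lt; try lra.
    apply Rdiv_lt_0_compat; lra. }
  assert (Htd : (t < d)%R).
  { unfold t in *. assert (H1 := Rmin_l (Rmin d d') (e / (2 * L * K + 1))).
    assert (H2 := Rmin_l d d'). lra. }
  assert (Htd' : (t < d')%R).
  { unfold t in *. assert (H1 := Rmin_l (Rmin d d') (e / (2 * L * K + 1))).
    assert (H2 := Rmin_r d d'). lra. }
  assert (Hte : (t * (2 * L * K + 1) < e)%R).
  { assert (H1 := Rmin_r (Rmin d d') (e / (2 * L * K + 1))). fold t in H1.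
    apply Rlt_le_trans with (e / (2 * L * K + 1) * (2 * L * K + 1))%R.
    - apply Rmult_lt_compat_r; [lra|]. unfold t in *. lra.
    - right. field. lra. }
  assert (Hpt : forall h, Cmod h = t ->
    (Cmod (G p + B * h + D * h ^ 2) ^ 2 - 2 * L * K * t ^ 3 + e * Cmod (p + h) ^ 2
     <= Cmod (G p) ^ 2 + e * Cmod p ^ 2)%R).
  { intros h Hh. assert (H1 := Hall h). assert (H2 := HR h). rewrite Hh in H1, H2.
    specialize (H1 Htd). specialize (H2 Htd').
    set (X := G p + B * h + D * h ^ 2) in *.
    assert (HX : (Cmod X <= L)%R).
    { unfold X, L. eapply Rle_trans; [apply Cmod_triangle|].
      apply Rplus_le_compat; [eapply Rle_trans; [apply Cmod_triangle|]; apply Rplus_le_compat|].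
      - lra.
      - rewrite Cmod_mult, Hh. assert (H3 := Cmod_ge_0 B). nra.
      - rewrite Cmod_mult, Cmod_pow, Hh. assert (H3 := Cmod_ge_0 D).
        assert (t ^ 2 <= 1)%R by nra. nra. }
    assert (HG : (Cmod X - K * t ^ 3 <= Cmod (G (p + h)%C))%R).
    { assert (H3 := Cmod_minus_ge X (- (G (p + h) - X))).
      replace (X - - (G (p + h) - X)) with (G (p + h)) in H3 by ring.
      rewrite Cmod_opp in H3. lra. }
    assert (HX0 := Cmod_ge_0 X). assert (HG0 := Cmod_ge_0 (G (p + h))).
    assert (Hr0 : (0 <= K * t ^ 3)%R) by (apply Rmult_le_pos; [lra | apply pow_le; lra]).
    set (rho := (K * t ^ 3)%R) in *. set (x := Cmod X) in *. set (g := Cmod (G (p + h))) in *.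
    replace (2 * L * K * t ^ 3)%R with (2 * L * rho)%R by (unfold rho; ring).
    assert (x * rho <= L * rho)%R by (apply Rmult_le_compat_r; auto).
    (* If x <= rho then x^2 - 2 L rho <= 0 already; otherwise g >= x - rho > 0 can be squared. *)
    destruct (Rle_lt_dec x rho); nra. }
  assert (E1 : Cmod (RtoC t) = t) by (rewrite Cmod_R, Rabs_pos_eq; lra).
  assert (E2 : Cmod (Ci * RtoC t) = t) by (rewrite Cmod_mult, Cmod_Ci, E1; ring).
  assert (P1 := Hpt _ E1). assert (P3 := Hpt _ E2).
  assert (P2 := Hpt (- RtoC t)). rewrite Cmod_opp in P2. specialize (P2 E1).
  assert (P4 := Hpt (- (Ci * RtoC t))). rewrite Cmod_opp in P4. specialize (P4 E2).
  assert (S1 := four_point_sum (G p) B D t). assert (S2 := four_point_abs p t).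
  cbv zeta in S1, S2.
  assert (T1 : (0 <= Cmod B ^ 2 * t ^ 2)%R) by (apply Rmult_le_pos; apply pow2_ge_0).
  assert (T2 : (0 <= Cmod D ^ 2 * t ^ 4)%R).
  { apply Rmult_le_pos; [apply pow2_ge_0 | apply pow_le; lra]. }
  assert (T3 : (e * t ^ 2 <= 2 * L * K * t ^ 3)%R) by nra.
  assert (T4 : (0 < t ^ 2)%R) by (apply pow_lt; auto).
  assert (T5 : (e <= 2 * L * K * t)%R).
  { apply Rmult_le_reg_r with (t ^ 2)%R; auto.
    replace (2 * L * K * t * t ^ 2)%R with (2 * L * K * t ^ 3)%R by ring. auto. }
  lra.
Qed.

(** The perturbed function |G|^2 + e |z|^2 has a maximum on the closed disk but no local maximum
    where G has a jet. The maximum is not at 0 either, since G and hence the perturbed function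
    vanish there. *)
Lemma punctured_max_modulus (G : C -> C) (r M : R) :
  (0 < r)%R ->
  (forall z, (0 < Cmod z <= r)%R -> jet2 G z) ->
  bigO 1 G ->
  (forall z, Cmod z = r -> (Cmod (G z) <= M)%R) ->
  forall z, (Cmod z <= r)%R -> (Cmod (G z) <= M)%R.
Proof.
  intros Hr HJ H0 HM z Hz. apply Rnot_lt_le; intro Hlt.
  assert (HM0 : (0 <= M)%R).
  { apply Rle_trans with (1 := Cmod_ge_0 (G r)). apply HM.
    rewrite Cmod_R, Rabs_pos_eq; lra. }
  (* With e r^2 equal to half the excess of |G z|^2 over M^2, the perturbation cannot lift the
     boundary values up to the value at z. *)
  set (e := ((Cmod (G z) ^ 2 - M ^ 2) / (2 * r ^ 2))%R).
  assert (Hr2 : (0 < r ^ 2)%R) by (apply pow_lt; auto).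
  assert (He : (0 < e)%R) by (apply Rdiv_lt_0_compat; nra).
  assert (Her : (e * r ^ 2 = (Cmod (G z) ^ 2 - M ^ 2) / 2)%R) by (unfold e; field; lra).
  set (phi := fun q => (Cmod (G q) ^ 2 + e * Cmod q ^ 2)%R).
  assert (Hcont : forall p, (Cmod p <= r)%R -> bigO 1 (fun h => G (p + h) - G p)).
  { intros p Hp. destruct (Ceq_dec p 0) as [-> | Hp0].
    - assert (E := bigO_at_zero _ _ Nat.lt_0_1 H0). rewrite E.
      apply bigO_ext with G; auto. intro h. rewrite Cplus_0_l. ring.
    - apply jet2_bigO1, HJ. split; auto. apply Cmod_gt_0; auto. }
  destruct (disk_attains_max phi r) as (p & Hp & Hmax); [lra | |].
  { intros p Hp m Hm. unfold phi in Hm.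
    set (c := (m - (Cmod (G p) ^ 2 + e * Cmod p ^ 2))%R).
    (* A local Lipschitz constant: if q - p and G q - G p are smaller than s <= 1, then phi q < phi
       p + s N. *)
    set (N := (2 * Cmod (G p) + 1 + e * (2 * Cmod p + 1))%R).
    assert (G0 := Cmod_ge_0 (G p)). assert (p0 := Cmod_ge_0 p).
    assert (HN : (1 <= N)%R) by (unfold N; nra).
    assert (Hc : (0 < c)%R) by (unfold c; lra).
    assert (Hs : (0 < Rmin 1 (c / N))%R) by (apply Rmin_glb_lt; [lra | apply Rdiv_lt_0_compat; lra]).
    destruct (bigO_small _ _ (Rmin 1 (c / N)) Nat.lt_0_1 (Hcont p Hp) Hs) as (d & Hd & H).
    exists (Rmin d (Rmin 1 (c / N))). split; [apply Rmin_glb_lt; auto|].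
    intros q _ Hqp.
    assert (K1 := H (q - p) (Rlt_le_trans _ _ _ Hqp (Rmin_l _ _))).
    replace (p + (q - p)) with q in K1 by ring.
    assert (K2 := Rlt_le_trans _ _ _ Hqp (Rmin_r _ _)).
    assert (K3 := Cmod_minus_ge (G q) (G q - G p)).
    replace (G q - (G q - G p)) with (G p) in K3 by ring.
    assert (K4 := Cmod_minus_ge q (q - p)).
    replace (q - (q - p)) with p in K4 by ring.
    assert (s1 := Rmin_l 1 (c / N)). assert (s2 := Rmin_r 1 (c / N)).
    set (s := Rmin 1 (c / N)) in *.
    assert (Hsc : (s * N <= c)%R).
    { apply Rle_trans with (c / N * N)%R; [apply Rmult_le_compat_r; lra | right; field; lra]. }
    assert (q0 := Cmod_ge_0 q). assert (Gq0 := Cmod_ge_0 (G q)).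
    assert (Q1 : (Cmod (G q) ^ 2 < Cmod (G p) ^ 2 + s * (2 * Cmod (G p) + 1))%R) by nra.
    assert (Q2 : (Cmod q ^ 2 < Cmod p ^ 2 + s * (2 * Cmod p + 1))%R) by nra.
    assert (Q3 : (e * Cmod q ^ 2 < e * (Cmod p ^ 2 + s * (2 * Cmod p + 1)))%R)
      by (apply Rmult_lt_compat_l; auto).
    unfold phi. unfold N, c in *. nra. }
  assert (Hpz : (M ^ 2 + e * r ^ 2 < phi p)%R).
  { apply Rlt_le_trans with (2 := Hmax z Hz). unfold phi.
    assert (0 <= e * Cmod z ^ 2)%R by (apply Rmult_le_pos; [lra | apply pow2_ge_0]). nra. }
  assert (Hp0 : p <> 0).
  { intros ->. unfold phi in Hpz. rewrite (bigO_at_zero _ _ Nat.lt_0_1 H0), Cmod_0 in Hpz. nra. }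
  assert (Hpr : (Cmod p < r)%R).
  { destruct Hp as [Hp | Hp]; auto. exfalso. unfold phi in Hpz.
    assert (H := HM p Hp). rewrite Hp in Hpz. assert (H1 := Cmod_ge_0 (G p)). nra. }
  apply Cmod_gt_0 in Hp0.
  destruct (no_local_max G p e (r - Cmod p)) as (q & Hq & Hlt'); auto; [lra|].
  assert (Hqr : (Cmod q <= r)%R).
  { replace q with (p + (q - p)) by ring. eapply Rle_trans; [apply Cmod_triangle|]. lra. }
  specialize (Hmax q Hqr). unfold phi in Hmax. lra.
Qed.

Lemma bigO_pow (n N : nat) (f : C -> C) : bigO n f -> bigO (N * n) (fun h => f h ^ N).
Proof.
  intros H; induction N as [|N IH]; simpl; [apply bigO_const|].
  apply (bigO_mult n (N * n)); auto.
Qed.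

(* The auxiliary power (s / z^n)^N * z vanishes at 0, so that no second-order expansion
   is needed there; the factor z disappears as N tends to infinity. *)
Lemma schwarz_leading_coef (s : C -> C) (n : nat) (A : C) :
  (forall z, (0 < Cmod z < 1)%R -> jet2 s z /\ (Cmod (s z) <= 1)%R) ->
  bigO (S n) (fun h => s h - A * h ^ n) -> (Cmod A <= 1)%R.
Proof.
  intros Hs HA. apply Rnot_lt_le; intro Hlt.
  (* Strictly between 1 and |A|; the point x below is so close to 0 that |s x| >= a x^n. *)
  set (a := ((1 + Cmod A) / 2)%R).
  destruct (bigO_elim _ _ HA) as (K & d & HK & Hd & H).
  set (x := (Rmin d ((Cmod A - a) / K) / 2)%R).
  assert (Hx0 : (0 < x)%R).
  { unfold x, a. apply Rdiv_lt_0_compat; [|lra]. apply Rmin_glb_lt; [lra|].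
    apply Rdiv_lt_0_compat; lra. }
  assert (Hxd : (x < d)%R).
  { unfold x in *. assert (H1 := Rmin_l d ((Cmod A - a) / K)). lra. }
  assert (HxK : (K * x <= Cmod A - a)%R).
  { assert (H1 := Rmin_r d ((Cmod A - a) / K)).
    apply Rle_trans with (K * ((Cmod A - a) / K))%R; [|right; field; lra].
    apply Rmult_le_compat_l; [lra|]. unfold x in *. lra. }
  assert (Ex : Cmod (RtoC x) = x) by (rewrite Cmod_R, Rabs_pos_eq; lra).
  assert (Hxn : (0 < x ^ n)%R) by (apply pow_lt; auto).
  assert (Hsx : (a * x ^ n <= Cmod (s x))%R).
  { specialize (H x). rewrite Ex in H. specialize (H Hxd). simpl in H.
    assert (H1 := Cmod_minus_ge (A * RtoC x ^ n) (- (s x - A * RtoC x ^ n))).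
    replace (A * RtoC x ^ n - - (s x - A * RtoC x ^ n)) with (s x) in H1 by ring.
    rewrite Cmod_opp, Cmod_mult, Cmod_pow, Ex in H1. nra. }
  assert (Ha : (1 < a)%R) by (unfold a; lra).
  assert (Hr : exists r, (x < r < 1)%R /\ (1 < a * r ^ n)%R).
  { assert (Hc : continuity_pt (fun r => a * r ^ n)%R 1) by (apply derivable_continuous_pt; reg).
    destruct (Hc ((a - 1) / 2)%R) as (al & Hal & Hc'); [lra|].
    set (r := (1 - Rmin al (1 - x) / 2)%R).
    assert (M1 := Rmin_l al (1 - x)). assert (M2 := Rmin_r al (1 - x)).
    assert (M3 : (0 < Rmin al (1 - x))%R) by (apply Rmin_glb_lt; lra).
    exists r. split; [unfold r; lra|].
    specialize (Hc' r). simpl in Hc'. unfold R_dist in Hc'.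
    rewrite pow1 in Hc'.
    assert (Q : (Rabs (a * r ^ n - a * 1) < (a - 1) / 2)%R).
    { apply Hc'. split; [split; [exact I | unfold r; lra]|].
      unfold r. rewrite Rabs_left; lra. }
    apply Rabs_lt_between in Q. lra. }
  destruct Hr as (r & Hr & Har).
  assert (Hrn : (0 < r ^ n)%R) by (apply pow_lt; lra).
  (* The maximum principle on |z| <= r, read at x, gives x a^N <= r / r^(nN). Since a r^n > 1, this
     fails for large N. *)
  assert (Key : forall N, (x * (a * r ^ n) ^ N <= r)%R).
  { intro N.
    set (G := fun z => z * (s z / z ^ n) ^ N).
    assert (HG : (Cmod (G x) <= r * (/ r ^ n) ^ N)%R).
    { apply punctured_max_modulus with r; [lra | | | | rewrite Ex; lra].
      - intros z Hz. assert (Hz0 : z <> 0) by (apply Cmod_gt_0; lra).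
        apply jet2_mult; [apply jet2_id | apply jet2_pow, jet2_div].
        + apply Cpow_nz; auto.
        + apply Hs; lra.
        + apply jet2_pow, jet2_id.
      - unfold G. apply (bigO_mult 1 0); [apply bigO_id|].
        rewrite <- (Nat.mul_0_r N). apply bigO_pow.
        (* The last summand covers h = 0, where the quotient has whatever value division by [0 ^ n]
           produces. *)
        apply bigO_intro with (Cmod A + K + Cmod (s 0 / 0 ^ n))%R d; [lra|]. intros h Hh.
        assert (A0 := Cmod_ge_0 A). assert (B0 := Cmod_ge_0 (s 0 / 0 ^ n)).
        destruct (Ceq_dec h 0) as [-> | Hh0]; [simpl; lra|].
        assert (Hhn := Cpow_nz h n Hh0).
        rewrite Cmod_div, Cmod_pow by auto. assert (Hh0' := Hh0). apply Cmod_gt_0 in Hh0'.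
        assert (Hhn' : (0 < Cmod h ^ n)%R) by (apply pow_lt; auto).
        specialize (H h Hh). simpl in H.
        assert (H1 := Cmod_triangle (s h - A * h ^ n) (A * h ^ n)).
        replace (s h - A * h ^ n + A * h ^ n) with (s h) in H1 by ring.
        rewrite Cmod_mult, Cmod_pow in H1.
        apply Rmult_le_reg_r with (Cmod h ^ n)%R; auto.
        replace (Cmod (s h) / Cmod h ^ n * Cmod h ^ n)%R with (Cmod (s h)) by (field; lra).
        simpl.
        assert (K * (Cmod h * Cmod h ^ n) <= K * Cmod h ^ n)%R.
        { apply Rmult_le_compat_l; [lra|]. nra. }
        nra.
      - intros z Hz. unfold G. assert (Hz0 : z <> 0) by (apply Cmod_gt_0; lra).
        rewrite Cmod_mult, Cmod_pow, Cmod_div, Cmod_pow, Hz by (apply Cpow_nz; auto).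
        apply Rmult_le_compat_l; [lra|]. apply pow_incr.
        assert (Hi := Rinv_0_lt_compat _ Hrn).
        split; [apply Rmult_le_pos; [apply Cmod_ge_0 | lra]|].
        rewrite <- (Rmult_1_l (/ r ^ n)). apply Rmult_le_compat_r; [lra|].
        apply Hs. lra. }
    assert (Hx0' : RtoC x <> 0) by (apply Cmod_gt_0; lra).
    unfold G in HG.
    rewrite Cmod_mult, Cmod_pow, Cmod_div, Cmod_pow, Ex in HG by (apply Cpow_nz; auto).
    rewrite Rpow_mult_distr.
    assert (Hrni := pow_lt _ N Hrn).
    apply Rmult_le_reg_r with ((/ r ^ n) ^ N)%R; [apply pow_lt, Rinv_0_lt_compat; auto|].
    apply Rle_trans with (2 := HG).
    replace (x * (a ^ N * (r ^ n) ^ N) * (/ r ^ n) ^ N)%R with (x * a ^ N)%R.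
    2:{ rewrite pow_inv. field. lra. }
    apply Rmult_le_compat_l; [lra|]. apply pow_incr. split; [lra|].
    apply Rmult_le_reg_r with (x ^ n)%R; auto.
    replace (Cmod (s x) / x ^ n * x ^ n)%R with (Cmod (s x)) by (field; lra). auto. }
  destruct (Pow_x_infinity (a * r ^ n) ltac:(rewrite Rabs_pos_eq; lra) (r / x + 1)) as [N HN].
  specialize (HN N (le_n N)). specialize (Key N).
  rewrite Rabs_pos_eq in HN by (apply pow_le; lra).
  apply Rge_le in HN. apply Rmult_le_compat_l with (r := x) in HN; [|lra].
  replace (x * (r / x + 1))%R with (r + x)%R in HN by (field; lra). lra.
Qed.

(** * Coefficients of Schwarz functions *)

Definition Csum (a : nat -> C) (n : nat) : C := @sum_n C_AbelianMonoid a n.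

Lemma Csum_S (a : nat -> C) (n : nat) : Csum a (S n) = Csum a n + a (S n).
Proof. unfold Csum; rewrite sum_Sn; reflexivity. Qed.

Lemma Csum_0 (a : nat -> C) : Csum a 0 = a 0%nat.
Proof. unfold Csum; rewrite sum_O; reflexivity. Qed.

Lemma Csum_ext (a b : nat -> C) (n : nat) :
  (forall k, (k <= n)%nat -> a k = b k) -> Csum a n = Csum b n.
Proof. exact (sum_n_ext_loc (G := C_AbelianMonoid) a b n). Qed.

Lemma Csum_scal (c : C) (a : nat -> C) (n : nat) :
  Csum (fun k => c * a k) n = c * Csum a n.
Proof. exact (sum_n_mult_l (K := C_Ring) c a n). Qed.

Lemma Csum_minus (a b : nat -> C) (n : nat) :
  Csum (fun k => a k - b k) n = Csum a n - Csum b n.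
Proof.
  induction n as [|n IH]; [rewrite !Csum_0 | rewrite !Csum_S, IH]; ring.
Qed.

Lemma Csum_const (c : C) (n : nat) : Csum (fun _ => c) n = INR (S n) * c.
Proof.
  induction n as [|n IH]; [rewrite Csum_0; simpl; ring|].
  rewrite Csum_S, IH, (S_INR (S n)), RtoC_plus. ring.
Qed.

Lemma Csum_switch (a : nat -> nat -> C) (m n : nat) :
  Csum (fun i => Csum (fun j => a i j) n) m = Csum (fun j => Csum (fun i => a i j) m) n.
Proof. exact (sum_n_switch (G := C_AbelianMonoid) a m n). Qed.

Lemma bigO_Csum (n : nat) (f : nat -> C -> C) (m : nat) :
  (forall j, bigO n (f j)) -> bigO n (fun h => Csum (fun j => f j h) m).
Proof.
  intros H; induction m as [|m IH].
  - apply bigO_ext with (f 0%nat); auto. intro; rewrite Csum_0; auto.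
  - eapply bigO_ext; [intro h; symmetry; apply Csum_S|]. apply bigO_plus; auto.
Qed.

Lemma jet2_Csum (f : nat -> C -> C) (z : C) (m : nat) :
  (forall j, jet2 (f j) z) -> jet2 (fun x => Csum (fun j => f j x) m) z.
Proof.
  intros H; induction m as [|m IH].
  - apply jet2_ext_loc with (f 0%nat) 1%R; [lra | | auto]. intros; rewrite Csum_0; auto.
  - apply jet2_ext_loc with (fun x => Csum (fun j => f j x) m + f (S m) x) 1%R;
      [lra | intros; rewrite Csum_S; auto | apply jet2_plus; auto].
Qed.

Lemma Csum_geom (x : C) (n : nat) : (x - 1) * Csum (fun j => x ^ j) n = x ^ S n - 1.
Proof.
  induction n as [|n IH]; [rewrite Csum_0; simpl; ring|].
  rewrite Csum_S, Cmult_plus_distr_l, IH. simpl. ring.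
Qed.

Lemma de_moivre (t : R) (k : nat) :
  ((cos t, sin t) : C) ^ k = (cos (INR k * t), sin (INR k * t)).
Proof.
  induction k as [|k IH].
  - simpl. rewrite Rmult_0_l, cos_0, sin_0. reflexivity.
  - rewrite Cpow_S, IH, S_INR.
    replace ((INR k + 1) * t)%R with (t + INR k * t)%R by ring.
    rewrite cos_plus, sin_plus. unfold Cmult; simpl. f_equal; ring.
Qed.

Lemma primitive_root (m : nat) :
  exists w : C, Cmod w = 1%R /\ w ^ S m = 1 /\
    forall k, (0 < k < S m)%nat -> w ^ k <> 1.
Proof.
  assert (Hm : (0 < INR (S m))%R) by (apply lt_0_INR; lia).
  set (t := (2 * PI / INR (S m))%R). exists (cos t, sin t).
  split; [|split].
  - unfold Cmod; simpl.
    replace (cos t * (cos t * 1) + sin t * (sin t * 1))%R with 1%R; [apply sqrt_1|].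
    assert (H := sin2_cos2 t). unfold Rsqr in H. lra.
  - rewrite de_moivre. unfold t.
    replace (INR (S m) * (2 * PI / INR (S m)))%R with (2 * PI)%R by (field; lra).
    rewrite cos_2PI, sin_2PI. reflexivity.
  - intros k Hk E. rewrite de_moivre in E. apply (f_equal fst) in E. simpl in E.
    assert (Hpi := PI_RGT_0).
    assert (Hk1 : (0 < INR k)%R) by (apply lt_0_INR; lia).
    assert (Hk2 : (INR k < INR (S m))%R) by (apply lt_INR; lia).
    (* Half the argument of w^k. It lies strictly between 0 and pi, so cos (2x) = 1 - 2 sin^2 x is
       less than 1. *)
    set (x := (INR k * PI / INR (S m))%R).
    replace (INR k * t)%R with (2 * x)%R in E by (unfold x, t; field; lra).
    assert (Hx0 : (0 < x)%R).
    { unfold x. apply Rdiv_lt_0_compat; auto. apply Rmult_lt_0_compat; auto. }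
    assert (Hx1 : (x < PI)%R).
    { unfold x. apply Rmult_lt_reg_r with (INR (S m)); auto.
      replace (INR k * PI / INR (S m) * INR (S m))%R with (INR k * PI)%R by (field; lra).
      rewrite (Rmult_comm PI). apply Rmult_lt_compat_r; auto. }
    assert (Hs := sin_gt_0 x Hx0 Hx1).
    rewrite cos_2a_sin in E. nra.
Qed.

Lemma re_Csum_ge (a : nat -> C) (c : R) (n : nat) :
  (forall k, (c <= Re (a k))%R) -> (INR (S n) * c <= Re (Csum a n))%R.
Proof.
  intros H; induction n as [|n IH].
  - rewrite Csum_0. simpl. rewrite Rmult_1_l. apply H.
  - rewrite Csum_S, re_plus, S_INR. specialize (H (S n)). lra.
Qed.

(* Averaging over the rotations by (m+1)-st roots of unity leaves only the coefficient
   of index m+1; then q / (1 + q) is a bounded function with the same leading term. *)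
Lemma half_plane_coef (u : C -> C) (U : nat -> C) (m : nat) :
  (forall z, (0 < Cmod z < 1)%R -> jet2 u z /\ (- (1 / 2) <= Re (u z))%R) ->
  U 0%nat = 0 ->
  bigO (S (S m)) (fun h => u h - Csum (fun k => U k * h ^ k) (S m)) ->
  (Cmod (U (S m)) <= 1)%R.
Proof.
  intros Hu HU0 HU.
  destruct (primitive_root m) as (w & Hw1 & Hwn & Hwk).
  assert (Hm : (0 < INR (S m))%R) by (apply lt_0_INR; lia).
  assert (HmC : RtoC (INR (S m)) <> 0) by (intro E; apply RtoC_inj in E; lra).
  assert (Hwj : forall j z, Cmod (w ^ j * z) = Cmod z).
  { intros j z. rewrite Cmod_mult, Cmod_pow, Hw1, pow1. ring. }
  set (q := fun z => / INR (S m) * Csum (fun j => u (w ^ j * z)) m).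
  assert (HqJ : forall z, (0 < Cmod z < 1)%R -> jet2 q z).
  { intros z Hz. apply jet2_scal, (jet2_Csum (fun j x => u (w ^ j * x))).
    intros j. apply jet2_dilate, Hu. rewrite Hwj; auto. }
  assert (HqR : forall z, (0 < Cmod z < 1)%R -> (- (1 / 2) <= Re (q z))%R).
  { intros z Hz. unfold q.
    assert (H := re_Csum_ge (fun j => u (w ^ j * z)) (- (1/2))%R m).
    set (S0 := Csum (fun j => u (w ^ j * z)) m) in *.
    assert (E : Re (/ INR (S m) * S0) = (/ INR (S m) * Re S0)%R).
    { rewrite <- RtoC_inv by lra. destruct S0; simpl; ring. }
    rewrite E. apply Rmult_le_reg_l with (INR (S m)); auto.
    rewrite <- Rmult_assoc, Rinv_r, Rmult_1_l by lra. apply H.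
    intro j. apply Hu. rewrite Hwj; auto. }
  (* Orthogonality of the roots of unity: among the indices k <= m + 1 only 0 and m + 1 survive the
     average, and U 0 = 0. *)
  assert (Hid : forall z, Csum (fun j => Csum (fun k => U k * (w ^ j * z) ^ k) (S m)) m
                  = INR (S m) * (U (S m) * z ^ S m)).
  { intro z. rewrite Csum_switch, Csum_S.
    assert (Hz : forall k, Csum (fun j => U k * (w ^ j * z) ^ k) m
                 = U k * z ^ k * Csum (fun j => (w ^ k) ^ j) m).
    { intro k. rewrite <- Csum_scal. apply Csum_ext. intros j _.
      rewrite Cpow_mult_l, <- !Cpow_mult_r, (Nat.mul_comm j k). ring. }
    rewrite Hz, Hwn.
    rewrite (Csum_ext (fun j => 1 ^ j) (fun _ => 1)) by (intros; apply Cpow_1_l).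
    rewrite Csum_const.
    rewrite (Csum_ext _ (fun _ => 0)), Csum_const; [ring|].
    intros k Hk. rewrite Hz. destruct k as [|k]; [rewrite HU0; ring|].
    assert (HG := Csum_geom (w ^ S k) m).
    rewrite <- Cpow_mult_r, Nat.mul_comm, Cpow_mult_r, Hwn, Cpow_1_l in HG.
    assert (Hne : w ^ S k - 1 <> 0).
    { intro E. apply (Hwk (S k)); [lia|].
      replace (w ^ S k) with (w ^ S k - 1 + 1) by ring. rewrite E. ring. }
    replace (Csum (fun j => (w ^ S k) ^ j) m)
      with (/ (w ^ S k - 1) * ((w ^ S k - 1) * Csum (fun j => (w ^ S k) ^ j) m))
      by (field; auto).
    rewrite HG. ring. }
  assert (HqO : bigO (S (S m)) (fun h => q h - U (S m) * h ^ S m)).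
  { apply bigO_ext with (fun h => / INR (S m) *
      Csum (fun j => u (w ^ j * h) - Csum (fun k => U k * (w ^ j * h) ^ k) (S m)) m).
    { intro h. rewrite Csum_minus, Hid. unfold q. field. auto. }
    apply bigO_scal.
    apply (bigO_Csum _ (fun j h => u (w ^ j * h) - Csum (fun k => U k * (w ^ j * h) ^ k) (S m))).
    intro j.
    assert (Hc : bigO 1 (fun h => w ^ j * h)) by auto using bigO_scal, bigO_id.
    assert (H := bigO_comp _ _ _ _ Nat.lt_0_1 HU Hc).
    rewrite Nat.mul_1_l in H. exact H. }
  assert (Hqn : bigO (S m) q).
  { apply bigO_ext with (fun h => (q h - U (S m) * h ^ S m) + U (S m) * h ^ S m); [intro; ring|].
    apply bigO_plus; [apply bigO_le with (2 := HqO); lia | apply bigO_scal, bigO_pow_id]. }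
  assert (Hne : forall z, (0 < Cmod z < 1)%R -> 1 + q z <> 0).
  { intros z Hz E. specialize (HqR z Hz). apply (f_equal Re) in E.
    rewrite re_plus in E. unfold Re in *. simpl in *. lra. }
  apply schwarz_leading_coef with (fun z => q z / (1 + q z)) (S m).
  - intros z Hz. split.
    + apply jet2_div; auto. apply jet2_plus; auto using jet2_const.
    + rewrite Cmod_div by auto.
      assert (Hp := Hne z Hz). apply Cmod_gt_0 in Hp.
      apply Rmult_le_reg_r with (Cmod (1 + q z)); auto.
      replace (Cmod (q z) / Cmod (1 + q z) * Cmod (1 + q z))%R with (Cmod (q z)) by (field; lra).
      (* |1 + q|^2 - |q|^2 = 1 + 2 Re q, which the half-plane condition makes nonnegative. *)
      rewrite Rmult_1_l. apply Rsqr_incr_0; auto using Cmod_ge_0.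
      unfold Rsqr. replace (Cmod (q z) * Cmod (q z))%R with (Cmod (q z) ^ 2)%R by ring.
      replace (Cmod (1 + q z) * Cmod (1 + q z))%R with (Cmod (1 + q z) ^ 2)%R by ring.
      rewrite !Cmod2_alt. specialize (HqR z Hz). destruct (q z) as [x y].
      simpl in *. nra.
  - assert (Hq1 : bigO 1 q) by (apply bigO_le with (2 := Hqn); lia).
    assert (Hinv : bigO 0 (fun h => / (1 + q h))).
    { apply bigO_inv; auto. apply Cmod_gt_0. rewrite Cmod_1. lra. }
    destruct (bigO_small _ _ 1%R Nat.lt_0_1 Hq1) as (e & He & Hqe); [lra|].
    (* q / (1 + q) differs from q by q^2 / (1 + q) = O(h^(2m+2)), which leaves the leading
       coefficient unchanged. *)
    apply bigO_ext_loc with (fun h => (q h - U (S m) * h ^ S m) - / (1 + q h) * (q h * q h)) e; auto.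
    { intros h Hh. field. intro E. specialize (Hqe h Hh).
      replace (q h) with (- (1) + (1 + q h)) in Hqe by ring. rewrite E in Hqe.
      replace (- (1) + 0) with (- (1)) in Hqe by ring. rewrite Cmod_m1 in Hqe. lra. }
    apply bigO_minus; auto.
    apply bigO_le with (0 + (S m + S m))%nat; [lia|].
    apply bigO_mult; auto. apply bigO_mult; auto.
Qed.

(** * Coefficients of v / (1 - v) for a Schwarz function v *)

Definition poly4 (c1 c2 c3 c4 z : C) : C := c1 * z + c2 * z ^ 2 + c3 * z ^ 3 + c4 * z ^ 4.

(** Taylor coefficients up to degree four of v / (1 - v) = v + v^2 + v^3 + ..., where v has the
    coefficients c1, ..., c4. *)
Definition ucoef (c1 c2 c3 c4 : C) (k : nat) : C :=
  match k with
  | 1 => c1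
  | 2 => c2 + c1 ^ 2
  | 3 => c3 + 2 * c1 * c2 + c1 ^ 3
  | 4 => c4 + 2 * c1 * c3 + c2 ^ 2 + 3 * c1 ^ 2 * c2 + c1 ^ 4
  | _ => 0
  end.

Lemma bigO_poly4 (c1 c2 c3 c4 : C) : bigO 1 (poly4 c1 c2 c3 c4).
Proof.
  unfold poly4. repeat apply bigO_plus; apply bigO_scal;
  [apply bigO_id | eapply bigO_le; [|apply bigO_pow_id]; lia ..].
Qed.

(** After multiplication by |1 - v|^2 the claim becomes |v|^2 <= 1. *)
Lemma re_div_one_minus (v : C) : (Cmod v < 1)%R -> (- (1 / 2) <= Re (v / (1 - v)))%R.
Proof.
  intro Hv. assert (Hv2 : (Cmod v ^ 2 < 1)%R) by (assert (H := Cmod_ge_0 v); nra).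
  rewrite Cmod2_alt in Hv2. destruct v as [x y]. unfold Re, Im in *. simpl in *.
  set (N := ((1 + - x) * ((1 + - x) * 1) + (0 + - y) * ((0 + - y) * 1))%R).
  assert (HN : (0 < N)%R) by (unfold N; nra).
  apply Rmult_le_reg_r with N; auto.
  match goal with |- (_ <= ?e * N)%R => replace (e * N)%R with (x * (1 - x) - y * y)%R end.
  - unfold N; nra.
  - field. lra.
Qed.

Lemma one_minus_neq_0 (v : C) : (Cmod v < 1)%R -> 1 - v <> 0.
Proof.
  intros Hv E. replace v with (1 - (1 - v)) in Hv by ring. rewrite E in Hv.
  replace (1 - 0) with (RtoC 1) in Hv by ring. rewrite Cmod_1 in Hv. lra.
Qed.

Lemma bigO_self (n : nat) (f p : C -> C) :
  bigO n p -> bigO n (fun h => f h - p h) -> bigO n f.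
Proof.
  intros Hp H. apply bigO_ext with (fun h => (f h - p h) + p h); [intro; ring|].
  apply bigO_plus; auto.
Qed.

Lemma bigO_id_bounded : bigO 0 (fun h => h).
Proof. apply bigO_le with 1%nat; [lia | apply bigO_id]. Qed.

Ltac bounded :=
  repeat (apply bigO_const || apply bigO_id_bounded || apply bigO_plus
          || apply bigO_opp || apply (bigO_mult 0 0)).

Lemma poly4_powers (c1 c2 c3 c4 : C) :
  let V := poly4 c1 c2 c3 c4 in
  bigO 5 (fun h => V h ^ 2 - (c1 ^ 2 * h ^ 2 + 2 * c1 * c2 * h ^ 3 + (2 * c1 * c3 + c2 ^ 2) * h ^ 4)) /\
  bigO 5 (fun h => V h ^ 3 - (c1 ^ 3 * h ^ 3 + 3 * c1 ^ 2 * c2 * h ^ 4)) /\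
  bigO 5 (fun h => V h ^ 4 - c1 ^ 4 * h ^ 4).
Proof.
  (* Horner tails: V h = h (c1 + h X1) and X1 = c2 + h X2, so that h^5 can be factored out of each
     remainder explicitly. *)
  intro V. set (X2 := fun h => c3 + h * c4). set (X1 := fun h => c2 + h * X2 h).
  split; [|split].
  - apply bigO_ext with (fun h =>
      (2 * c1 * c4 + 2 * c2 * X2 h + h * (X2 h * X2 h)) * h ^ 5).
    { intro; unfold X2, V, poly4; ring. }
    apply (bigO_mult 0 5); [unfold X2; bounded | apply bigO_pow_id].
  - apply bigO_ext with (fun h =>
      (3 * (c1 * c1) * X2 h + 3 * c1 * (X1 h * X1 h) + h * (X1 h * (X1 h * X1 h))) * h ^ 5).
    { intro; unfold X1, X2, V, poly4; ring. }
    apply (bigO_mult 0 5); [unfold X1, X2; bounded | apply bigO_pow_id].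
  - apply bigO_ext with (fun h =>
      (X1 h * (4 * (c1 * (c1 * c1)) + 6 * (c1 * c1) * (h * X1 h)
       + 4 * c1 * (h * X1 h * (h * X1 h)) + h * X1 h * (h * X1 h * (h * X1 h)))) * h ^ 5).
    { intro; unfold X1, X2, V, poly4; ring. }
    apply (bigO_mult 0 5); [unfold X1, X2; bounded | apply bigO_pow_id].
Qed.

Lemma schwarz_rogosinski (v : C -> C) (c1 c2 c3 c4 : C) (m : nat) :
  (forall z, (0 < Cmod z < 1)%R -> jet2 v z /\ (Cmod (v z) < 1)%R) ->
  bigO 5 (fun h => v h - poly4 c1 c2 c3 c4 h) ->
  (m <= 3)%nat ->
  (Cmod (ucoef c1 c2 c3 c4 (S m)) <= 1)%R.
Proof.
  intros Hv HO Hm.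
  apply half_plane_coef with (fun z => v z / (1 - v z)); auto.
  { intros z Hz. destruct (Hv z Hz) as [HJ Hlt]. split.
    - apply jet2_div; auto using one_minus_neq_0.
      apply jet2_plus; [apply jet2_const|].
      apply jet2_ext_loc with (fun x => (- (1)) * v x) 1%R; [lra | intros; ring |].
      apply jet2_scal; auto.
    - apply re_div_one_minus; auto. }
  set (V := poly4 c1 c2 c3 c4).
  assert (HV : bigO 1 V) by apply bigO_poly4.
  assert (Hv1 : bigO 1 v).
  { apply bigO_self with V; auto. apply bigO_le with 5%nat; [lia | auto]. }
  assert (HV0 : bigO 0 V) by (apply bigO_le with 1%nat; auto).
  assert (Hv0 : bigO 0 v) by (apply bigO_le with 1%nat; auto).
  assert (H5 : bigO 5 (fun h => v h / (1 - v h) - Csum (fun k => ucoef c1 c2 c3 c4 k * h ^ k) 4)).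
  { destruct (bigO_small _ _ 1%R Nat.lt_0_1 Hv1) as (e & He & Hve); [lra|].
    (* v / (1 - v) = v + v^2 + v^3 + v^4 + v^5 / (1 - v). The differences v^k - V^k are factored
       through v - V, and the powers of V are then replaced by their truncations. *)
    apply bigO_ext_loc with (fun h =>
      (1 + (v h + V h) + (v h * v h + v h * V h + V h * V h)
         + (v h + V h) * (v h * v h + V h * V h)) * (v h - V h)
      + / (1 + - v h) * (v h * (v h * (v h * (v h * v h))))
      + ((V h ^ 2 - (c1 ^ 2 * h ^ 2 + 2 * c1 * c2 * h ^ 3 + (2 * c1 * c3 + c2 ^ 2) * h ^ 4))
         + ((V h ^ 3 - (c1 ^ 3 * h ^ 3 + 3 * c1 ^ 2 * c2 * h ^ 4))
            + (V h ^ 4 - c1 ^ 4 * h ^ 4)))) e; auto.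
    { intros h Hh. assert (H := one_minus_neq_0 _ (Hve h Hh)).
      rewrite !Csum_S, Csum_0. unfold V, poly4; simpl ucoef. field.
      intro E; apply H; rewrite <- E; ring. }
    apply bigO_plus; [apply bigO_plus|].
    - apply (bigO_mult 0 5); [|exact HO]. bounded; auto.
    - apply (bigO_mult 0 5).
      + apply bigO_inv; [apply Cmod_gt_0; rewrite Cmod_1; lra | apply bigO_opp; auto].
      + repeat (apply (bigO_mult 1); auto).
    - destruct (poly4_powers c1 c2 c3 c4) as (H2 & H3 & H4).
      apply (bigO_plus _ _ _ H2 (bigO_plus _ _ _ H3 H4)). }
  apply bigO_ext with (fun h => (v h / (1 - v h) - Csum (fun k => ucoef c1 c2 c3 c4 k * h ^ k) 4)
     + (Csum (fun k => ucoef c1 c2 c3 c4 k * h ^ k) 4 - Csum (fun k => ucoef c1 c2 c3 c4 k * h ^ k) (S m))).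
  { intro; ring. }
  apply bigO_plus; [apply bigO_le with (2 := H5); lia|].
  destruct m as [|[|[|[|m]]]]; [ | | | | lia].
  - apply bigO_ext with (fun h => (ucoef c1 c2 c3 c4 2 + ucoef c1 c2 c3 c4 3 * h
      + ucoef c1 c2 c3 c4 4 * (h * h)) * h ^ 2).
    { intro h. rewrite !Csum_S. ring. }
    apply (bigO_mult 0 2); [bounded | apply bigO_pow_id].
  - apply bigO_ext with (fun h => (ucoef c1 c2 c3 c4 3 + ucoef c1 c2 c3 c4 4 * h) * h ^ 3).
    { intro h. rewrite !Csum_S. ring. }
    apply (bigO_mult 0 3); [bounded | apply bigO_pow_id].
  - apply bigO_ext with (fun h => ucoef c1 c2 c3 c4 4 * h ^ 4).
    { intro h. rewrite !Csum_S. ring. }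
    apply bigO_scal, bigO_pow_id.
  - apply bigO_ext with (fun _ => 0); [intro; ring | apply bigO_zero].
Qed.

(** All that the coefficient estimates use of w; at the origin only the polynomial expansion is
    asked. *)
Definition schwarz_jet (w : C -> C) (c1 c2 c3 c4 : C) : Prop :=
  (forall z, (0 < Cmod z < 1)%R -> jet2 w z /\ (Cmod (w z) < 1)%R) /\
  bigO 5 (fun h => w h - poly4 c1 c2 c3 c4 h).

(** zeta^n times the coefficient of index n of u for eta = 1/zeta. No negative powers occur, so
    averaging over zeta produces moments of orders 0 to n - 1. *)
Definition rogosinski (c1 c2 c3 c4 zeta : C) (n : nat) : C :=
  match n with
  | 1 => c1
  | 2 => zeta * c2 + c1 ^ 2
  | 3 => zeta ^ 2 * c3 + zeta * (2 * c1 * c2) + c1 ^ 3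
  | 4 => zeta ^ 3 * c4 + zeta ^ 2 * (2 * c1 * c3 + c2 ^ 2) + zeta * (3 * c1 ^ 2 * c2) + c1 ^ 4
  | _ => 0
  end.

Lemma rogosinski_le (w : C -> C) (c1 c2 c3 c4 zeta : C) (n : nat) :
  schwarz_jet w c1 c2 c3 c4 -> Cmod zeta = 1%R ->
  (Cmod (rogosinski c1 c2 c3 c4 zeta n) <= 1)%R.
Proof.
  intros [Hw HO] Hz.
  assert (Hz0 : zeta <> 0) by (apply Cmod_gt_0; lra).
  set (eta := / zeta).
  assert (He : Cmod eta = 1%R) by (unfold eta; rewrite Cmod_inv, Hz by auto; apply Rinv_1).
  assert (H : forall m, (m <= 3)%nat ->
    (Cmod (ucoef (eta * c1) (eta * c2) (eta * c3) (eta * c4) (S m)) <= 1)%R).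
  { intros m Hm. apply schwarz_rogosinski with (fun z => eta * w z); auto.
    - intros z Hzz. destruct (Hw z Hzz) as [HJ Hlt]. split; [apply jet2_scal; auto|].
      rewrite Cmod_mult, He. lra.
    - apply bigO_ext with (fun h => eta * (w h - poly4 c1 c2 c3 c4 h)).
      { intro; unfold poly4; ring. }
      apply bigO_scal; auto. }
  assert (H0 : (Cmod 0 <= 1)%R) by (rewrite Cmod_0; lra).
  assert (HE : forall m, (m <= 3)%nat -> rogosinski c1 c2 c3 c4 zeta (S m) =
     zeta ^ S m * ucoef (eta * c1) (eta * c2) (eta * c3) (eta * c4) (S m)).
  { intros m Hm. destruct m as [|[|[|[|m]]]]; [ | | | | lia]; simpl; unfold eta; field; auto. }
  destruct n as [|n]; [exact H0|].
  destruct (Nat.le_gt_cases n 3) as [Hn | Hn].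
  - rewrite HE, Cmod_mult, Cmod_pow, Hz, pow1, Rmult_1_l by auto. auto.
  - do 4 (destruct n as [|n]; [lia|]). exact H0.
Qed.

(** * Bounds for the three functionals by positive masses on the circle *)

Lemma Cmod_scal_le (m : R) (x : C) : (0 <= m)%R -> (Cmod x <= 1)%R -> (Cmod (m * x) <= m)%R.
Proof.
  intros Hm Hx. rewrite Cmod_mult, Cmod_R, Rabs_pos_eq by auto. nra.
Qed.

Lemma Cmod_plus_le (x y : C) (a b : R) :
  (Cmod x <= a)%R -> (Cmod y <= b)%R -> (Cmod (x + y) <= a + b)%R.
Proof. intros; eapply Rle_trans; [apply Cmod_triangle | lra]. Qed.

Lemma Cmod_pair_1 (x y : R) : (x ^ 2 + y ^ 2 = 1)%R -> Cmod (x, y) = 1%R.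
Proof. intro H; unfold Cmod; simpl fst; simpl snd; rewrite H; apply sqrt_1. Qed.

(** The masses 3/2, 1/2 at 1, -1 have total 2 and first moment 1, the coefficients of c1^2 and
    c2. *)
Lemma functional2_le (w : C -> C) (c1 c2 c3 c4 : C) :
  schwarz_jet w c1 c2 c3 c4 -> (Cmod (c2 + 2 * c1 ^ 2) <= 2)%R.
Proof.
  intros H.
  replace (c2 + 2 * c1 ^ 2) with
    (RtoC (3 / 2) * rogosinski c1 c2 c3 c4 1 2 + RtoC (1 / 2) * rogosinski c1 c2 c3 c4 (- (1)) 2).
  2:{ unfold rogosinski. rewrite !RtoC_div by lra. field. }
  apply Rle_trans with (3 / 2 + 1 / 2)%R; [|lra].
  apply Cmod_plus_le; apply Cmod_scal_le; try lra; eapply rogosinski_le; eauto;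
    auto using Cmod_1, Cmod_m1.
Qed.

(* The masses 7/4, 3/8, 3/8 at the points 1, i, -i have the moments 5/2, 7/4, 1. *)
Lemma functional3_le (w : C -> C) (c1 c2 c3 c4 : C) :
  schwarz_jet w c1 c2 c3 c4 ->
  (Cmod (c3 + RtoC (7 / 2) * c1 * c2 + RtoC (5 / 2) * c1 ^ 3) <= 5 / 2)%R.
Proof.
  intros H.
  replace (c3 + RtoC (7 / 2) * c1 * c2 + RtoC (5 / 2) * c1 ^ 3) with
    (RtoC (7 / 4) * rogosinski c1 c2 c3 c4 1 3
     + (RtoC (3 / 8) * rogosinski c1 c2 c3 c4 (0%R, 1%R) 3
        + RtoC (3 / 8) * rogosinski c1 c2 c3 c4 (0%R, (-1)%R) 3)).
  2:{ unfold rogosinski.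
      destruct c1 as [x1 y1], c2 as [x2 y2], c3 as [x3 y3].
      apply injective_projections; simpl; field. }
  replace (5 / 2)%R with (7 / 4 + (3 / 8 + 3 / 8))%R by field.
  repeat apply Cmod_plus_le; apply Cmod_scal_le; try lra; eapply rogosinski_le; eauto;
    try apply Cmod_1; apply Cmod_pair_1; ring.
Qed.

(* Masses at 1, -1, (4 +- 3i)/5, (3 +- 4i)/5 whose moments are 13, 11, 9, 6. *)
Lemma functional4_le (w : C -> C) (c1 c2 c3 c4 : C) :
  schwarz_jet w c1 c2 c3 c4 ->
  (Cmod (c4 + RtoC (10 / 3) * c1 * c3 + RtoC (3 / 2) * c2 ^ 2
         + RtoC (37 / 6) * c1 ^ 2 * c2 + RtoC (5 / 2) * c1 ^ 4) <= 5 / 2)%R.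
Proof.
  intros H.
  set (Z := fun zeta => rogosinski c1 c2 c3 c4 zeta 4).
  (* Points with rational coordinates keep all moments rational; conjugate points get equal masses,
     so the moments are real. The masses are divided by 6 to give c4 the coefficient 1. *)
  set (z1 := (4 / 5, 3 / 5)%R : C). set (z2 := (4 / 5, - (3 / 5))%R : C).
  set (z3 := (3 / 5, 4 / 5)%R : C). set (z4 := (3 / 5, - (4 / 5))%R : C).
  set (E1 := RtoC (147 / 16 / 6)). set (E2 := RtoC (221 / 576 / 6)).
  set (E3 := RtoC (25 / 72 / 6)). set (E4 := RtoC (175 / 128 / 6)).
  assert (M0 : E1 + E2 + E3 + E3 + E4 + E4 = RtoC (13 / 6)).
  { unfold E1, E2, E3, E4. apply injective_projections; simpl; field. }
  assert (M1 : E1 * 1 + E2 * - (1) + E3 * z1 + E3 * z2 + E4 * z3 + E4 * z4 = RtoC (11 / 6)).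
  { unfold E1, E2, E3, E4, z1, z2, z3, z4. apply injective_projections; simpl; field. }
  assert (M2 : E1 * 1 ^ 2 + E2 * (- (1)) ^ 2 + E3 * z1 ^ 2 + E3 * z2 ^ 2
     + E4 * z3 ^ 2 + E4 * z4 ^ 2 = RtoC (9 / 6)).
  { unfold E1, E2, E3, E4, z1, z2, z3, z4. apply injective_projections; simpl; field. }
  assert (M3 : E1 * 1 ^ 3 + E2 * (- (1)) ^ 3 + E3 * z1 ^ 3 + E3 * z2 ^ 3
     + E4 * z3 ^ 3 + E4 * z4 ^ 3 = RtoC (6 / 6)).
  { unfold E1, E2, E3, E4, z1, z2, z3, z4. apply injective_projections; simpl; field. }
  assert (HZ : E1 * Z 1 + (E2 * Z (- (1)) + (E3 * Z z1 + (E3 * Z z2 + (E4 * Z z3 + E4 * Z z4))))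
     = RtoC (6 / 6) * c4 + RtoC (9 / 6) * (2 * c1 * c3 + c2 ^ 2)
       + RtoC (11 / 6) * (3 * c1 ^ 2 * c2) + RtoC (13 / 6) * c1 ^ 4).
  { rewrite <- M0, <- M1, <- M2, <- M3. unfold Z, rogosinski. ring. }
  (* Removing a third of c1 times the third coefficient turns 10/3, 37/6, 5/2 into 3, 11/2, 13/6,
     which are 2, 3, 1 times the moments 9/6, 11/6, 13/6; the coefficient of c2^2 remains 9/6. *)
  replace (c4 + RtoC (10 / 3) * c1 * c3 + RtoC (3 / 2) * c2 ^ 2
         + RtoC (37 / 6) * c1 ^ 2 * c2 + RtoC (5 / 2) * c1 ^ 4)
    with (RtoC (1 / 3) * (c1 * rogosinski c1 c2 c3 c4 1 3) +
      (E1 * Z 1 + (E2 * Z (- (1)) + (E3 * Z z1 + (E3 * Z z2 + (E4 * Z z3 + E4 * Z z4)))))).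
  2:{ rewrite HZ. unfold rogosinski.
      rewrite !RtoC_div by lra.
      replace (RtoC 6) with (RtoC 2 * RtoC 3) by (rewrite <- RtoC_mult; f_equal; ring).
      field. }
  replace (5 / 2)%R with (1 / 3 + (147 / 16 / 6 + (221 / 576 / 6 + (25 / 72 / 6
    + (25 / 72 / 6 + (175 / 128 / 6 + 175 / 128 / 6))))))%R by field.
  assert (HZle : forall z, Cmod z = 1%R -> (Cmod (Z z) <= 1)%R).
  { intros z Hz. apply (rogosinski_le w); auto. }
  repeat apply Cmod_plus_le; apply Cmod_scal_le; try lra; try apply HZle;
    auto using Cmod_1, Cmod_m1; try (apply Cmod_pair_1; field).
  rewrite Cmod_mult.
  assert (R1 := rogosinski_le w c1 c2 c3 c4 1 1 H Cmod_1).
  assert (R3 := rogosinski_le w c1 c2 c3 c4 1 3 H Cmod_1).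
  simpl rogosinski at 1 in R1.
  assert (G1 := Cmod_ge_0 c1). assert (G3 := Cmod_ge_0 (rogosinski c1 c2 c3 c4 1 3)).
  nra.
Qed.

(** * Complex power series *)

Local Notation Cseries := (@is_series C_AbsRing C_NormedModule).
Local Notation Cpseries := (@is_pseries C_AbsRing C_NormedModule).

Lemma Cpow_pow_n (z : C) (n : nat) : @pow_n C_Ring z n = z ^ n.
Proof. induction n as [|n IH]; [reflexivity|]. simpl. rewrite IH. reflexivity. Qed.

Lemma Cpseries_series (b : nat -> C) (z l : C) :
  Cpseries b z l <-> Cseries (fun n => b n * z ^ n) l.
Proof.
  assert (E : forall n, @scal C_AbsRing C_NormedModule (pow_n z n) (b n) = b n * z ^ n).
  { intro n. rewrite (Cmult_comm (b n)), <- (Cpow_pow_n z n). reflexivity. }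
  unfold is_pseries. split; apply is_series_ext; intro n; rewrite E; reflexivity.
Qed.

Lemma Cseries_ext (a b : nat -> C) (l : C) :
  (forall n, a n = b n) -> Cseries a l -> Cseries b l.
Proof. intros E; apply is_series_ext; auto. Qed.

Lemma Cseries_plus (a b : nat -> C) (la lb : C) :
  Cseries a la -> Cseries b lb -> Cseries (fun n => a n + b n) (la + lb).
Proof. intros; apply (is_series_plus (V := C_NormedModule)); auto. Qed.

Lemma Cseries_scal (c : C) (a : nat -> C) (l : C) :
  Cseries a l -> Cseries (fun n => c * a n) (c * l).
Proof. intros; apply (is_series_scal (V := C_NormedModule)); auto. Qed.

Lemma Cseries_minus (a b : nat -> C) (la lb : C) :
  Cseries a la -> Cseries b lb -> Cseries (fun n => a n - b n) (la - lb).
Proof.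
  intros Ha Hb. apply Cseries_plus; auto.
  replace (- lb) with ((- (1)) * lb) by ring.
  apply Cseries_ext with (fun n => (- (1)) * b n); [intro; ring | apply Cseries_scal; auto].
Qed.

Lemma Cmod_series_le (a : nat -> C) (b : nat -> R) (l : C) (s : R) :
  Cseries a l -> (forall n, (Cmod (a n) <= b n)%R) -> is_series b s -> (Cmod l <= s)%R.
Proof.
  intros Ha Hab Hb.
  assert (H1 : filterlim (fun n => norm (sum_n (G := C_NormedModule) a n)) eventually (locally (norm l))).
  { apply filterlim_comp with (locally l); auto. apply (filterlim_norm (V := C_NormedModule)). }
  assert (H := filterlim_le (F := eventually) (fun n => norm (sum_n (G := C_NormedModule) a n))
     (fun n => sum_n b n) (norm l) s). simpl in H.
  apply H; auto.
  exists 0%nat. intros n _. unfold sum_n.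
  eapply Rle_trans; [apply (norm_sum_n_m (V := C_NormedModule))|].
  apply sum_n_m_le. intro k. apply Hab.
Qed.

Lemma ex_Cseries_le (a : nat -> C) (b : nat -> R) :
  (forall n, (Cmod (a n) <= b n)%R) -> ex_series b -> exists l, Cseries a l.
Proof.
  intros Hab Hb.
  apply (ex_series_le (V := C_CompleteNormedModule) a b); auto.
Qed.

Lemma Cseries_terms_bounded (a : nat -> C) (l : C) :
  Cseries a l -> exists M, (0 <= M)%R /\ forall n, (Cmod (a n) <= M)%R.
Proof.
  intros Ha.
  destruct (filterlim_bounded (V := C_NormedModule) (sum_n (G := C_NormedModule) a)) as [M HM]; [exists l; auto|].
  assert (HS : forall n, (Cmod (Csum a n) <= M)%R) by (intro n; apply (HM n)).
  assert (HM0 : (0 <= M)%R) by (eapply Rle_trans; [apply (Cmod_ge_0 (Csum a 0)) | auto]).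
  exists (2 * M)%R. split; [lra|]. intros [|n].
  - rewrite <- Csum_0. specialize (HS 0%nat). lra.
  - replace (a (S n)) with (Csum a (S n) - Csum a n) by (rewrite Csum_S; ring).
    eapply Rle_trans; [apply Cmod_triangle|]. rewrite Cmod_opp.
    assert (H1 := HS n). assert (H2 := HS (S n)). lra.
Qed.

Lemma Cseries_Csum (a : nat -> nat -> C) (l : nat -> C) (m : nat) :
  (forall k, (k <= m)%nat -> Cseries (fun n => a n k) (l k)) ->
  Cseries (fun n => Csum (a n) m) (Csum l m).
Proof.
  induction m as [|m IH]; intros H.
  - rewrite Csum_0. apply Cseries_ext with (fun n => a n 0%nat); auto.
    intro; rewrite Csum_0; auto.
  - rewrite Csum_S. apply Cseries_ext with (fun n => Csum (a n) m + a n (S m)).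
    { intro; rewrite Csum_S; auto. }
    apply Cseries_plus; auto.
Qed.

(* binomial(n, m) z^(n - m) *)
Fixpoint taylor_mono (z : C) (n m : nat) : C :=
  match n, m with
  | O, O => 1
  | O, S _ => 0
  | S n', O => z * taylor_mono z n' 0
  | S n', S m' => z * taylor_mono z n' (S m') + taylor_mono z n' m'
  end.

(** The Taylor remainder of (z + h)^n after degree m, divided by h^(m+1); the recursion avoids
    dividing by h. *)
Fixpoint taylor_rem (z h : C) (m n : nat) : C :=
  match n with
  | O => 0
  | S n' => (z + h) * taylor_rem z h m n' + taylor_mono z n' m
  end.

Lemma taylor_mono_step (z h : C) (n m : nat) :
  Csum (fun k => taylor_mono z (S n) k * h ^ k) m
  = (z + h) * Csum (fun k => taylor_mono z n k * h ^ k) m - taylor_mono z n m * h ^ S m.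
Proof.
  induction m as [|m IH].
  - rewrite !Csum_0. simpl. ring.
  - rewrite !Csum_S, IH. simpl. ring.
Qed.

Lemma taylor_mono_rem (z h : C) (m n : nat) :
  (z + h) ^ n = Csum (fun k => taylor_mono z n k * h ^ k) m + h ^ S m * taylor_rem z h m n.
Proof.
  induction n as [|n IH].
  - simpl taylor_rem. rewrite Cmult_0_r, Cplus_0_r.
    induction m as [|m IHm]; [rewrite Csum_0; simpl; ring|].
    rewrite Csum_S, <- IHm. simpl. ring.
  - rewrite taylor_mono_step, Cpow_S, IH. simpl. ring.
Qed.

Section Bounds.

Variables (r s : R) (z : C).
Hypotheses (Hr : (0 <= r < s)%R) (Hz : (Cmod z <= r)%R).

(** A single term of the binomial expansion of s^n = (r + (s - r))^n is at most s^n. The induction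
    uses this in the form r K + 1 = K s with K = 1/(s - r). *)
Lemma taylor_mono_bound (n m : nat) :
  (Cmod (taylor_mono z n m) <= (/ (s - r)) ^ m * s ^ n)%R.
Proof.
  set (K := (/ (s - r))%R).
  assert (HK : (0 < K)%R) by (apply Rinv_0_lt_compat; lra).
  assert (HKs : (r * K + 1 = K * s)%R) by (unfold K; field; lra).
  assert (Hs : forall n, (0 < s ^ n)%R) by (intro; apply pow_lt; lra).
  assert (HKm : forall n, (0 < K ^ n)%R) by (intro; apply pow_lt; lra).
  revert m; induction n as [|n IH]; intros [|m]; simpl taylor_mono.
  - rewrite Cmod_1; simpl; lra.
  - rewrite Cmod_0. apply Rmult_le_pos; apply Rlt_le; auto.
  - rewrite Cmod_mult. specialize (IH 0%nat). simpl in *.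
    assert (H0 := Cmod_ge_0 (taylor_mono z n 0)). assert (H1 := Cmod_ge_0 z).
    specialize (Hs n). nra.
  - eapply Rle_trans; [apply Cmod_triangle|]. rewrite Cmod_mult.
    assert (I1 := IH (S m)). assert (I2 := IH m).
    assert (H1 := Cmod_ge_0 z). assert (H0 := Cmod_ge_0 (taylor_mono z n (S m))).
    assert (Cmod z * Cmod (taylor_mono z n (S m)) <= r * (K ^ S m * s ^ n))%R
      by (apply Rmult_le_compat; auto).
    replace (K ^ S m * s ^ S n)%R with (K ^ m * s ^ n * (K * s))%R by (simpl; ring).
    rewrite <- HKs. simpl in *. lra.
Qed.

Lemma taylor_rem_bound (h : C) (m n : nat) :
  (Cmod (z + h) <= r)%R ->
  (Cmod (taylor_rem z h m n) <= (/ (s - r)) ^ S m * s ^ n)%R.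
Proof.
  intros Hzh.
  set (K := (/ (s - r))%R).
  assert (HK : (0 < K)%R) by (apply Rinv_0_lt_compat; lra).
  assert (HKs : (r * K + 1 = K * s)%R) by (unfold K; field; lra).
  induction n as [|n IH]; simpl taylor_rem.
  - rewrite Cmod_0. apply Rmult_le_pos; apply pow_le; lra.
  - eapply Rle_trans; [apply Cmod_triangle|]. rewrite Cmod_mult.
    assert (I2 := taylor_mono_bound n m). fold K in I2.
    assert (Cmod (z + h) * Cmod (taylor_rem z h m n) <= r * (K ^ S m * s ^ n))%R
      by (apply Rmult_le_compat; auto using Cmod_ge_0).
    replace (K ^ S m * s ^ S n)%R with (K ^ m * s ^ n * (K * s))%R by (simpl; ring).
    rewrite <- HKs. simpl in *. lra.
Qed.

End Bounds.

Lemma power_coef_bound (b : nat -> C) (f : C -> C) (t : R) :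
  (forall z, inD z -> Cpseries b z (f z)) -> (0 <= t < 1)%R ->
  exists M, (0 <= M)%R /\ forall n, (Cmod (b n) * t ^ n <= M)%R.
Proof.
  intros Hf Ht.
  assert (Ht' : Cmod (RtoC t) = t) by (rewrite Cmod_R, Rabs_pos_eq; lra).
  assert (H := Hf (RtoC t)). unfold inD in H. rewrite Ht' in H. specialize (H (proj2 Ht)).
  apply Cpseries_series in H. destruct (Cseries_terms_bounded _ _ H) as (M & HM & HM').
  exists M. split; auto. intro n. specialize (HM' n).
  rewrite Cmod_mult, Cmod_pow, Ht' in HM'. auto.
Qed.

(** The gap s < t turns mere boundedness of |b n| t^n into geometric decay. *)
Lemma geom_domination (b : nat -> C) (s t M K : R) (x : nat -> C) :
  (0 < s < t)%R -> (0 <= K)%R ->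
  (forall n, (Cmod (b n) * t ^ n <= M)%R) ->
  (forall n, (Cmod (x n) <= K * s ^ n)%R) ->
  forall n, (Cmod (b n * x n) <= M * K * (s / t) ^ n)%R.
Proof.
  intros Hst HK Hb Hx n. rewrite Cmod_mult.
  assert (Htn : (0 < t ^ n)%R) by (apply pow_lt; lra).
  assert (Hsn : (0 < s ^ n)%R) by (apply pow_lt; lra).
  unfold Rdiv. rewrite Rpow_mult_distr, pow_inv.
  apply Rle_trans with (Cmod (b n) * (K * s ^ n))%R.
  { apply Rmult_le_compat_l; auto using Cmod_ge_0. }
  replace (Cmod (b n) * (K * s ^ n))%R with (Cmod (b n) * t ^ n * (K * s ^ n * / t ^ n))%R
    by (field; lra).
  replace (M * K * (s ^ n * / t ^ n))%R with (M * (K * s ^ n * / t ^ n))%R by ring.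
  apply Rmult_le_compat_r; auto.
  apply Rmult_le_pos; [nra | apply Rlt_le, Rinv_0_lt_compat; auto].
Qed.

Lemma ratio_lt_1 (s t : R) : (0 < s < t)%R -> (Rabs (s / t) < 1)%R.
Proof.
  intro H. rewrite Rabs_pos_eq.
  - apply Rmult_lt_reg_r with t; [lra|]. unfold Rdiv.
    rewrite Rmult_assoc, Rinv_l; lra.
  - apply Rlt_le, Rdiv_lt_0_compat; lra.
Qed.

Lemma is_series_scal_geom (c s t : R) :
  (0 < s < t)%R -> is_series (fun n => c * (s / t) ^ n)%R (c * / (1 - s / t))%R.
Proof.
  intros H. apply (is_series_scal (V := R_NormedModule) c), is_series_geom, ratio_lt_1; auto.
Qed.

Section PowerSeries.

Variables (b : nat -> C) (f : C -> C).
Hypothesis (Hf : forall z, inD z -> Cpseries b z (f z)).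

Lemma ex_taylor_coef (z : C) (m : nat) :
  inD z -> exists l, Cseries (fun n => b n * taylor_mono z n m) l.
Proof.
  intro Hz. unfold inD in Hz. assert (H0 := Cmod_ge_0 z).
  (* |z| < s < t < 1: the Taylor monomials grow at most like s^n, and the coefficients are
     O(t^(-n)). *)
  set (s := ((Cmod z + 1) / 2)%R). set (t := ((s + 1) / 2)%R).
  destruct (power_coef_bound b f t Hf) as (M & HM & Hb); [unfold t, s; lra|].
  apply ex_Cseries_le with (fun n => M * (/ (s - Cmod z)) ^ m * (s / t) ^ n)%R.
  - apply geom_domination; auto; [unfold t, s; lra | |].
    + apply pow_le, Rlt_le, Rinv_0_lt_compat; unfold s; lra.
    + intro n. apply taylor_mono_bound; unfold s; lra.
  - eexists; apply is_series_scal_geom. unfold t, s; lra.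
Qed.

(** Each power (z + h)^n is expanded separately. What remains is h^(m+1) times a series dominated by
    a geometric one, uniformly in small h. *)
Lemma power_series_jet (z : C) (m : nat) (a : nat -> C) :
  inD z ->
  (forall k, (k <= m)%nat -> Cseries (fun n => b n * taylor_mono z n k) (a k)) ->
  bigO (S m) (fun h => f (z + h) - Csum (fun k => a k * h ^ k) m).
Proof.
  intros Hz Ha. unfold inD in Hz. assert (H0 := Cmod_ge_0 z).
  set (r := ((Cmod z + 1) / 2)%R). set (s := ((r + 1) / 2)%R). set (t := ((s + 1) / 2)%R).
  destruct (power_coef_bound b f t Hf) as (M & HM & Hb); [unfold t, s, r; lra|].
  assert (Hst : (0 < s < t)%R) by (unfold t, s, r; lra).
  set (K := ((/ (s - r)) ^ S m)%R).
  apply bigO_intro with (M * K * / (1 - s / t))%R (r - Cmod z)%R; [unfold r; lra|].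
  intros h Hh.
  assert (Hzh : (Cmod (z + h) <= r)%R) by (eapply Rle_trans; [apply Cmod_triangle | lra]).
  assert (Hs : Cseries (fun n => h ^ S m * (b n * taylor_rem z h m n))
                (f (z + h) - Csum (fun k => a k * h ^ k) m)).
  { apply Cseries_ext with (fun n => b n * (z + h) ^ n
       - Csum (fun k => b n * taylor_mono z n k * h ^ k) m).
    - intro n. rewrite (taylor_mono_rem z h m n).
      rewrite (Csum_ext (fun k => b n * taylor_mono z n k * h ^ k)
        (fun k => b n * (taylor_mono z n k * h ^ k))) by (intros; ring).
      rewrite Csum_scal. ring.
    - apply Cseries_minus.
      + apply Cpseries_series, Hf. unfold inD. unfold r in *; lra.
      + apply (Cseries_Csum (fun n k => b n * taylor_mono z n k * h ^ k) (fun k => a k * h ^ k)).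
        intros k Hk. rewrite Cmult_comm.
        apply Cseries_ext with (fun n => h ^ k * (b n * taylor_mono z n k)); [intro; ring|].
        apply Cseries_scal; auto. }
  apply Cmod_series_le with (1 := Hs) (b := fun n => (Cmod h ^ S m * (M * K * (s / t) ^ n))%R).
  - intro n. rewrite Cmod_mult, Cmod_pow.
    apply Rmult_le_compat_l; [apply pow_le, Cmod_ge_0|].
    apply geom_domination; auto.
    + apply pow_le, Rlt_le, Rinv_0_lt_compat; unfold s, r; lra.
    + intro k. apply taylor_rem_bound; auto; unfold s, r; lra.
  - rewrite (Rmult_comm (M * K * / (1 - s / t))).
    apply (is_series_scal (V := R_NormedModule)).
    apply is_series_scal_geom; auto.
Qed.

Lemma taylor_mono_0 (z : C) (n : nat) : taylor_mono z n 0 = z ^ n.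
Proof. induction n as [|n IH]; simpl; rewrite ?IH; auto. Qed.

Lemma taylor_mono_1 (z : C) (n : nat) : taylor_mono z (S n) 1 = INR (S n) * z ^ n.
Proof.
  induction n as [|n IH]; [simpl; ring|].
  change (taylor_mono z (S (S n)) 1) with (z * taylor_mono z (S n) 1 + taylor_mono z (S n) 0).
  rewrite IH, taylor_mono_0, (S_INR (S n)), RtoC_plus, Cpow_S. ring.
Qed.

Lemma taylor_mono_at_0 (n m : nat) : taylor_mono 0 n m = if Nat.eq_dec n m then 1 else 0.
Proof.
  revert m; induction n as [|n IH]; intros [|m]; simpl taylor_mono; auto.
  - destruct (Nat.eq_dec (S n) 0); [lia | ring].
  - rewrite (IH m). destruct (Nat.eq_dec n m), (Nat.eq_dec (S n) (S m)); try lia; ring.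
Qed.

Lemma Cseries_single (x : C) (m : nat) :
  Cseries (fun n => x * (if Nat.eq_dec n m then 1 else 0)) x.
Proof.
  apply filterlim_ext_loc with (fun _ => x); [|apply filterlim_const].
  exists m. intros n Hn. symmetry.
  change (Csum (fun n => x * (if Nat.eq_dec n m then 1 else 0)) n = x).
  assert (Hlt : forall n, (n < m)%nat -> Csum (fun n => x * (if Nat.eq_dec n m then 1 else 0)) n = 0).
  { clear n Hn. intros n Hn. rewrite (Csum_ext _ (fun _ => 0)); [rewrite Csum_const; ring|].
    intros k Hk. destruct (Nat.eq_dec k m); [lia | ring]. }
  induction Hn as [|n Hn IH].
  - destruct m as [|m].
    + rewrite Csum_0. destruct (Nat.eq_dec 0 0); [ring | lia].
    + rewrite Csum_S, Hlt by lia. destruct (Nat.eq_dec (S m) (S m)); [ring | lia].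
  - rewrite Csum_S, IH. destruct (Nat.eq_dec (S n) m); [lia | ring].
Qed.

Lemma power_series_jet_0 (m : nat) :
  bigO (S m) (fun h => f h - Csum (fun k => b k * h ^ k) m).
Proof.
  apply bigO_ext with (fun h => f (0 + h) - Csum (fun k => b k * h ^ k) m).
  { intro; rewrite Cplus_0_l; auto. }
  apply power_series_jet.
  - unfold inD; rewrite Cmod_0; lra.
  - intros k _. eapply Cseries_ext; [|apply (Cseries_single (b k) k)].
    intro n. simpl. rewrite taylor_mono_at_0.
    destruct (Nat.eq_dec n k) as [-> | ]; auto. ring.
Qed.

Lemma power_series_jet2 (z : C) : inD z -> jet2 f z.
Proof.
  intro Hz.
  destruct (ex_taylor_coef z 0 Hz) as [A HA], (ex_taylor_coef z 1 Hz) as [B HB],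
    (ex_taylor_coef z 2 Hz) as [D HD].
  exists A, B, D.
  apply bigO_ext with (fun h => f (z + h) -
    Csum (fun k => match k with 0%nat => A | 1%nat => B | _ => D end * h ^ k) 2).
  - intro h. rewrite !Csum_S, Csum_0. simpl. ring.
  - apply power_series_jet; auto. intros [|[|[|k]]] Hk; auto. lia.
Qed.

Lemma power_series_derivative :
  exists df : C -> C,
    (forall z, inD z -> Cpseries (fun n => INR (S n) * b (S n)) z (df z)) /\
    (forall z, inD z -> der f z (df z)).
Proof.
  (* Membership in the disk stands inside the existential, so that choice yields a total
     function. *)
  assert (H : forall z : C, exists l : C, inD z -> Cseries (fun n => b n * taylor_mono z n 1) l).
  { intro z. destruct (classic (inD z)) as [Hz | Hz].
    - destruct (ex_taylor_coef z 1 Hz) as [l Hl]. exists l; auto.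
    - exists (RtoC 0). tauto. }
  set (df := fun z : C => proj1_sig (constructive_indefinite_description _ (H z))).
  assert (Hdf : forall z, inD z -> Cseries (fun n => b n * taylor_mono z n 1) (df z)).
  { intro z. unfold df. apply (proj2_sig (constructive_indefinite_description _ (H z))). }
  exists df. split; intros z Hz.
  - apply Cpseries_series.
    apply Cseries_ext with (fun n => b (S n) * taylor_mono z (S n) 1).
    { intro n. rewrite taylor_mono_1. ring. }
    (* Dropping the term n = 0 does not change the sum, because [taylor_mono z 0 1] is 0. *)
    apply (is_series_incr_1 (V := C_NormedModule) (fun n => b n * taylor_mono z n 1)).
    apply (eq_ind (df z) (fun l : C => Cseries (fun n => b n * taylor_mono z n 1) l)
      (Hdf z Hz) (df z + b 0%nat * 0)). ring.
  - unfold der.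
    apply bigO_ext with (fun h => f (z + h) - Csum (fun k =>
       match k with 0%nat => f z | _ => df z end * h ^ k) 1).
    { intro h. rewrite Csum_S, Csum_0. simpl. ring. }
    apply power_series_jet; auto.
    intros [|[|k]] Hk; [ | auto | lia].
    apply Cseries_ext with (2 := proj1 (Cpseries_series b z (f z)) (Hf z Hz)).
    intro n. rewrite taylor_mono_0. auto.
Qed.

End PowerSeries.

(** * Complex derivatives and the exponential *)

Lemma der_bigO1 (g : C -> C) (z l : C) : der g z l -> bigO 1 (fun h => g (z + h) - g z).
Proof.
  intro H. apply bigO_ext with (fun h => (g (z + h) - g z - l * h) + l * h); [intro; ring|].
  apply bigO_plus; [apply bigO_le with 2%nat; auto | apply bigO_scal, bigO_id].
Qed.

Lemma der_bounded (g : C -> C) (z l : C) : der g z l -> bigO 0 (fun h => g (z + h)).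
Proof.
  intro H. apply der_bigO1 in H.
  apply bigO_ext with (fun h => (g (z + h) - g z) + g z); [intro; ring|].
  apply bigO_plus; [apply bigO_le with 1%nat; auto | apply bigO_const].
Qed.

Lemma der_id (z : C) : der (fun x => x) z 1.
Proof. apply bigO_ext with (fun _ => 0); [intro; ring | apply bigO_zero]. Qed.

Lemma der_mult (f g : C -> C) (z l m : C) :
  der f z l -> der g z m -> der (fun x => f x * g x) z (l * g z + f z * m).
Proof.
  intros Hf Hg. assert (Bg := der_bounded _ _ _ Hg).
  apply bigO_ext with (fun h =>
    g (z + h) * (f (z + h) - f z - l * h) + (f z + l * h) * (g (z + h) - g z - m * h)
    + l * m * h ^ 2); [intro; ring|].
  apply bigO_plus; [apply bigO_plus|].
  - apply (bigO_mult 0 2); auto.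
  - apply (bigO_mult 0 2); auto. bounded.
  - apply bigO_scal, bigO_pow_id.
Qed.

Lemma der_comp (f g : C -> C) (z l m : C) :
  der g z m -> der f (g z) l -> der (fun x => f (g x)) z (l * m).
Proof.
  intros Hg Hf. assert (Hg1 := der_bigO1 _ _ _ Hg).
  assert (H := bigO_comp 2 1 _ _ Nat.lt_0_1 Hf Hg1). rewrite Nat.mul_1_l in H.
  eapply bigO_ext; [|apply (bigO_plus _ _ _ H (bigO_scal _ l _ Hg))].
  intro h; simpl. replace (g z + (g (z + h) - g z)) with (g (z + h)) by ring. ring.
Qed.

Lemma der_is_derive (g : C -> C) (z l : C) :
  der g z l -> @is_derive C_AbsRing C_NormedModule g z l.
Proof.
  intro H. split; [apply is_linear_scal_l|].
  intros x Hx. apply (is_filter_lim_locally_unique (V := AbsRing_NormedModule C_AbsRing)) in Hx.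
  change (z = x) in Hx. subst x.
  intro eps. destruct (bigO_elim _ _ H) as (K & d & HK & Hd & HO).
  assert (Hd' : (0 < Rmin d (eps / K))%R).
  { apply Rmin_glb_lt; [lra|]. apply Rdiv_lt_0_compat; [apply cond_pos | auto]. }
  exists (mkposreal _ Hd'). intros y0 Hy. set (y := y0 : C).
  change (Cmod (y - z) < Rmin d (eps / K))%R in Hy.
  change (Cmod (g y - g z - (y - z) * l) <= eps * Cmod (y - z))%R.
  specialize (HO (y - z) (Rlt_le_trans _ _ _ Hy (Rmin_l _ _))).
  replace (z + (y - z)) with y in HO by ring.
  rewrite (Cmult_comm (y - z)). apply Rle_trans with (1 := HO).
  replace (K * Cmod (y - z) ^ 2)%R with (K * Cmod (y - z) * Cmod (y - z))%R by ring.
  apply Rmult_le_compat_r; [apply Cmod_ge_0|].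
  apply Rle_trans with (K * (eps / K))%R; [|right; field; lra].
  apply Rmult_le_compat_l; [lra|].
  apply Rlt_le, Rlt_le_trans with (1 := Hy), Rmin_r.
Qed.

Lemma is_derive_small (g : C -> C) (z l : C) :
  @is_derive C_AbsRing C_NormedModule g z l ->
  forall eps, (0 < eps)%R -> exists d, (0 < d)%R /\
    forall h, (Cmod h < d)%R -> (Cmod (g (z + h) - g z - l * h)%C <= eps * Cmod h)%R.
Proof.
  intros [_ H] eps He. specialize (H z).
  assert (Hz : is_filter_lim (locally (T := AbsRing_NormedModule C_AbsRing) z) z)
    by (intros P HP; exact HP).
  destruct (H Hz (mkposreal eps He)) as [d Hd].
  exists d. split; [apply cond_pos|]. intros h Hh.
  specialize (Hd (z + h)).
  change ((Cmod (z + h - z)%C < d)%R ->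
    (Cmod (g (z + h) - g z - (z + h - z) * l)%C <= eps * Cmod (z + h - z)%C)%R) in Hd.
  replace (z + h - z) with h in Hd by ring. rewrite (Cmult_comm l). auto.
Qed.

Lemma is_derive_bigO1 (g : C -> C) (z l : C) :
  @is_derive C_AbsRing C_NormedModule g z l -> bigO 1 (fun h => g (z + h) - g z).
Proof.
  intro H. destruct (is_derive_small _ _ _ H 1%R Rlt_0_1) as (d & Hd & Hs).
  apply bigO_intro with (1 + Cmod l)%R d; auto. intros h Hh. specialize (Hs h Hh).
  assert (T := Cmod_triangle (g (z + h) - g z - l * h) (l * h)).
  replace (g (z + h) - g z - l * h + l * h) with (g (z + h) - g z) in T by ring.
  rewrite Cmod_mult in T. simpl. lra.
Qed.

Lemma der_is_derive_unique (g : C -> C) (z l l' : C) :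
  der g z l -> @is_derive C_AbsRing C_NormedModule g z l' -> l' = l.
Proof.
  intros H H'.
  assert (E : Cmod (l - l') = 0%R).
  { apply Rle_antisym; [|apply Cmod_ge_0]. apply Rnot_lt_le; intro Hlt.
    set (e := (Cmod (l - l') / 4)%R). assert (He : (0 < e)%R) by (unfold e; lra).
    destruct (is_derive_small _ _ _ (der_is_derive _ _ _ H) e He) as (d & Hd & Hs).
    destruct (is_derive_small _ _ _ H' e He) as (d' & Hd' & Hs').
    set (t := (Rmin d d' / 2)%R).
    assert (M1 := Rmin_l d d'). assert (M2 := Rmin_r d d').
    assert (M3 : (0 < Rmin d d')%R) by (apply Rmin_glb_lt; auto).
    assert (Et : Cmod (RtoC t) = t) by (rewrite Cmod_R, Rabs_pos_eq; unfold t; lra).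
    specialize (Hs t). specialize (Hs' t). rewrite Et in Hs, Hs'.
    assert (Hs1 := Hs ltac:(unfold t; lra)). assert (Hs2 := Hs' ltac:(unfold t; lra)).
    assert (T := Cmod_triangle (g (z + t) - g z - l' * t) (- (g (z + t) - g z - l * t))).
    replace (g (z + t) - g z - l' * t + - (g (z + t) - g z - l * t))
      with ((l - l') * t) in T by ring.
    rewrite Cmod_opp, Cmod_mult, Et in T.
    assert (0 < t)%R by (unfold t; lra). unfold e in *. nra. }
  apply Cmod_eq_0 in E. replace l' with (l - (l - l')) by ring. rewrite E. ring.
Qed.

(** [Cderiv] is chosen by [epsilon], so its value is accessible only through uniqueness of the
    derivative. *)
Lemma der_Cderiv (g : C -> C) (z l : C) : der g z l -> Cderiv g z = l.
Proof.
  intro H. apply der_is_derive_unique with g z; auto.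
  unfold Cderiv. apply epsilon_spec. exists l. apply der_is_derive; auto.
Qed.

Lemma inD_segment (z : C) (t : R) : inD z -> (0 <= t <= 1)%R -> inD (t * z).
Proof.
  unfold inD. intros Hz Ht. rewrite Cmod_mult, Cmod_R, Rabs_pos_eq by lra.
  assert (H := Cmod_ge_0 z). nra.
Qed.

(** Along the segment from 0 to z the real and imaginary parts of g are real functions with zero
    derivative. This serves as the uniqueness theorem for the differential equations below. *)
Lemma der_zero_const (g : C -> C) :
  (forall z, inD z -> der g z 0) -> forall z, inD z -> g z = g 0.
Proof.
  intros H z Hz.
  assert (Hpart : forall p : C -> R, (forall x y, p (x - y) = (p x - p y)%R) ->
    (forall x, (Rabs (p x) <= Cmod x)%R) -> p (g z) = p (g 0)).
  { intros p Hp Hpl.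
    replace z with (RtoC 1 * z) by ring. replace (RtoC 0) with (RtoC 0 * z) by ring.
    symmetry. apply (eq_is_derive (fun t : R => p (g (t * z))) 0 1); [|lra].
    intros t Ht. apply is_derive_Reals. intros eps He.
    destruct (bigO_elim _ _ (H _ (inD_segment z t Hz Ht))) as (K & d & HK & Hd & HO).
    assert (Hz0 := Cmod_ge_0 z). unfold inD in Hz.
    assert (Hd' : (0 < Rmin d (eps / (K + 1)))%R).
    { apply Rmin_glb_lt; [lra | apply Rdiv_lt_0_compat; lra]. }
    exists (mkposreal _ Hd'). simpl. intros s Hs0 Hs.
    rewrite <- Hp. unfold zero; simpl. rewrite Rminus_0_r.
    replace (RtoC (t + s) * z) with (RtoC t * z + RtoC s * z) by (rewrite RtoC_plus; ring).
    assert (Hsz : (Cmod (s * z) <= Rabs s)%R).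
    { rewrite Cmod_mult, Cmod_R. assert (Hss := Rabs_pos s). nra. }
    assert (Hs1 := Rlt_le_trans _ _ _ Hs (Rmin_l _ _)).
    assert (Hs2 := Rlt_le_trans _ _ _ Hs (Rmin_r _ _)).
    specialize (HO (s * z)).
    replace (g (t * z + s * z) - g (t * z) - 0 * (s * z))
      with (g (t * z + s * z) - g (t * z)) in HO by ring.
    specialize (HO ltac:(lra)).
    set (D := g (t * z + s * z) - g (t * z)) in *.
    assert (Hs3 : (0 < Rabs s)%R) by (apply Rabs_pos_lt; auto).
    unfold Rdiv. rewrite Rabs_mult, Rabs_inv.
    apply Rmult_lt_reg_r with (Rabs s); auto.
    rewrite Rmult_assoc, Rinv_l, Rmult_1_r by lra.
    apply Rle_lt_trans with (1 := Hpl D). apply Rle_lt_trans with (1 := HO).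
    assert (Hc := Cmod_ge_0 (s * z)).
    apply Rle_lt_trans with (K * Rabs s ^ 2)%R.
    { apply Rmult_le_compat_l; [lra|]. apply pow_incr. lra. }
    assert (Hs4 : (Rabs s * (K + 1) < eps)%R).
    { apply Rlt_le_trans with (eps / (K + 1) * (K + 1))%R;
      [apply Rmult_lt_compat_r; lra | right; field; lra]. }
    nra. }
  apply injective_projections.
  - apply (Hpart fst); [intros [] []; reflexivity | apply re_le_Cmod].
  - apply (Hpart snd); [intros [] []; reflexivity | apply im_le_Cmod].
Qed.

(** * The complex exponential *)

Lemma cexp_plus (x y : C) : cexp (x + y) = cexp x * cexp y.
Proof.
  destruct x as [a b], y as [c d]. unfold cexp, Cmult; simpl.
  rewrite exp_plus, cos_plus, sin_plus. f_equal; ring.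
Qed.

Lemma cexp_0 : cexp 0 = 1.
Proof. unfold cexp; simpl. rewrite exp_0, cos_0, sin_0. apply injective_projections; simpl; ring. Qed.

Lemma cexp_inv (z : C) : cexp z * cexp (- z) = 1.
Proof. rewrite <- cexp_plus. replace (z + - z) with (RtoC 0) by ring. apply cexp_0. Qed.

Lemma cexp_neq_0 (z : C) : cexp z <> 0.
Proof.
  intro E. assert (H := cexp_inv z). rewrite E, Cmult_0_l in H.
  apply RtoC_inj in H. lra.
Qed.

Lemma abs_sin_le (b : R) : (Rabs (sin b) <= Rabs b)%R.
Proof.
  destruct (MVT_gen sin 0 b cos) as (c & _ & E).
  - intros; auto_derive; auto; ring.
  - intros; apply continuity_sin.
  - rewrite sin_0, !Rminus_0_r in E. rewrite E, Rabs_mult.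
    assert (H := COS_bound c). assert (H1 := Rabs_pos b).
    assert (Rabs (cos c) <= 1)%R by (apply Rabs_le; lra). nra.
Qed.

(** Half-angle formula: 1 - cos b = 2 sin^2 (b/2). *)
Lemma one_minus_cos_le (b : R) : (Rabs (cos b - 1) <= b ^ 2 / 2)%R.
Proof.
  replace (cos b) with (cos (2 * (b / 2)))%R by (f_equal; field).
  rewrite cos_2a_sin. assert (H := abs_sin_le (b / 2)).
  assert (H0 := Rabs_pos (sin (b / 2))).
  assert (E1 := pow2_abs (sin (b / 2))). assert (E2 := pow2_abs (b / 2)).
  rewrite Rabs_left1; nra.
Qed.

Lemma sin_minus_id_le (b : R) : (Rabs b <= 1)%R -> (Rabs (sin b - b) <= b ^ 2)%R.
Proof.
  intro Hb.
  destruct (MVT_gen (fun x => sin x - x)%R 0 b (fun x => cos x - 1)%R) as (c & Hc & E).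
  - intros; auto_derive; auto; ring.
  - intros; reg.
  - rewrite sin_0, !Rminus_0_r in E. rewrite E, Rabs_mult.
    assert (H := one_minus_cos_le c).
    assert (Hcb : (Rabs c <= Rabs b)%R).
    { unfold Rmin, Rmax in Hc. destruct (Rle_dec 0 b).
      - rewrite !Rabs_pos_eq; lra.
      - rewrite !Rabs_left1; lra. }
    assert (H0 := Rabs_pos c). assert (H1 := Rabs_pos b).
    rewrite <- (pow2_abs c) in H. rewrite <- (pow2_abs b). nra.
Qed.

(** From 1 - a <= e^(-a) one gets e^a <= 1/(1 - a), hence 0 <= e^a - 1 - a <= a^2/(1 - a). *)
Lemma exp_minus_one_id_le (a : R) : (Rabs a <= 1 / 2)%R -> (Rabs (exp a - 1 - a) <= 2 * a ^ 2)%R.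
Proof.
  intro Ha. apply Rabs_le_between in Ha.
  assert (H1 := exp_ineq1_le a). assert (H2 := exp_ineq1_le (- a)).
  assert (H3 : (exp a * (1 - a) <= 1)%R).
  { apply Rle_trans with (exp a * exp (- a))%R.
    - apply Rmult_le_compat_l; [apply Rlt_le, exp_pos | lra].
    - rewrite <- exp_plus. replace (a + - a)%R with 0%R by ring. rewrite exp_0; lra. }
  rewrite Rabs_pos_eq by lra. nra.
Qed.

(** The only estimate made on real and imaginary parts. The addition formula carries it to every
    point as a derivative, and the power series follows from the differential equation. *)
Lemma cexp_bigO2 : bigO 2 (fun h => cexp h - 1 - h).
Proof.
  apply bigO_intro with 6%R (1 / 2)%R; [lra|]. intros h Hh.
  eapply Rle_trans; [apply Cmod_le_abs|]. rewrite Cmod2_alt.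
  assert (A := re_le_Cmod h). assert (B := im_le_Cmod h).
  destruct h as [a b]. unfold Re, Im in *. simpl fst in *. simpl snd in *.
  assert (Ea := exp_minus_one_id_le a ltac:(lra)).
  assert (Eb := sin_minus_id_le b ltac:(lra)).
  assert (Ec := one_minus_cos_le b).
  assert (Hab : (Rabs a <= 1/2)%R) by lra.
  assert (He : (0 < exp a <= 2)%R).
  { split; [apply exp_pos|]. apply Rabs_le_between in Ea. apply Rabs_le_between in Hab. nra. }
  assert (Ed : (Rabs (exp a - 1) <= 2 * Rabs a)%R).
  { replace (exp a - 1)%R with ((exp a - 1 - a) + a)%R by ring.
    eapply Rle_trans; [apply Rabs_triang|]. rewrite <- (pow2_abs a) in Ea.
    assert (H := Rabs_pos a). nra. }
  replace (exp a * cos b + - (1) + - a)%R with (exp a * (cos b - 1) + (exp a - 1 - a))%R by ring.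
  replace (exp a * sin b + - 0 + - b)%R with (exp a * (sin b - b) + b * (exp a - 1))%R by ring.
  assert (T1 := Rabs_triang (exp a * (cos b - 1)) (exp a - 1 - a)).
  assert (T2 := Rabs_triang (exp a * (sin b - b)) (b * (exp a - 1))).
  rewrite !Rabs_mult, (Rabs_pos_eq (exp a)) in T1 by lra.
  rewrite !Rabs_mult, (Rabs_pos_eq (exp a)) in T2 by lra.
  assert (P1 := Rabs_pos (cos b - 1)). assert (P2 := Rabs_pos (sin b - b)).
  assert (P3 := Rabs_pos b). assert (P4 := Rabs_pos a).
  assert (Q1 : (exp a * Rabs (cos b - 1) <= b ^ 2)%R) by nra.
  assert (Q2 : (exp a * Rabs (sin b - b) <= 2 * b ^ 2)%R) by nra.
  assert (Q3 : (Rabs b * Rabs (exp a - 1) <= b ^ 2 + a ^ 2)%R).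
  { rewrite <- (pow2_abs a), <- (pow2_abs b).
    apply Rle_trans with (Rabs b * (2 * Rabs a))%R; [apply Rmult_le_compat_l; auto|].
    assert (H := pow2_ge_0 (Rabs a - Rabs b)). nra. }
  nra.
Qed.

Lemma der_cexp (z : C) : der cexp z (cexp z).
Proof.
  apply bigO_ext with (fun h => cexp z * (cexp h - 1 - h)).
  - intro h. rewrite cexp_plus. ring.
  - apply bigO_scal, cexp_bigO2.
Qed.

Lemma Cseries_unique (a : nat -> C) (l l' : C) : Cseries a l -> Cseries a l' -> l = l'.
Proof.
  intros H H'.
  exact (filterlim_locally_unique (V := C_NormedModule) (F := eventually) _ _ _ H H').
Qed.

Lemma ex_power_series (b : nat -> C) :
  (forall n, (Cmod (b n) <= 1)%R) ->
  exists f : C -> C, forall z, inD z -> Cpseries b z (f z).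
Proof.
  intro Hb.
  assert (H : forall z : C, exists l : C, inD z -> Cpseries b z l).
  { intro z. destruct (classic (inD z)) as [Hz | Hz]; [|exists (RtoC 0); tauto].
    unfold inD in Hz. assert (H0 := Cmod_ge_0 z).
    destruct (ex_Cseries_le (fun n => b n * z ^ n) (fun n => Cmod z ^ n)%R) as [l Hl].
    - intro n. rewrite Cmod_mult, Cmod_pow. assert (H1 := Hb n).
      assert (H2 := pow_le _ n H0). nra.
    - apply ex_series_geom. rewrite Rabs_pos_eq; lra.
    - exists l. intros _. apply Cpseries_series; auto. }
  exists (fun z => proj1_sig (constructive_indefinite_description _ (H z))).
  intro z. apply (proj2_sig (constructive_indefinite_description _ (H z))).
Qed.

Lemma power_series_at_0 (b : nat -> C) (f : C -> C) :
  (forall z, inD z -> Cpseries b z (f z)) -> f 0 = b 0%nat.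
Proof.
  intro Hf. assert (H := power_series_jet_0 b f Hf 0).
  apply bigO_at_zero in H; [|lia]. rewrite Csum_0 in H. simpl in H.
  replace (f 0) with (f 0 - b 0%nat * 1 + b 0%nat) by ring. rewrite H. ring.
Qed.

Lemma inv_fact_le_1 (n : nat) : (0 < / INR (fact n) <= 1)%R.
Proof.
  assert (H : (1 <= INR (fact n))%R) by (apply (le_INR 1), lt_O_fact).
  split; [apply Rinv_0_lt_compat; lra|].
  rewrite <- Rinv_1. apply Rinv_le_contravar; lra.
Qed.

(** The sum E of the exponential series satisfies E' = E, so E(x) e^(-x) has zero derivative and
    keeps its value 1 at 0. *)
Lemma cexp_power_series (z : C) :
  inD z -> Cpseries (fun n => RtoC (/ INR (fact n))) z (cexp z).
Proof.
  set (e := fun n => RtoC (/ INR (fact n))).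
  destruct (ex_power_series e) as [E HE].
  { intro n. unfold e. assert (H := inv_fact_le_1 n). rewrite Cmod_R, Rabs_pos_eq; lra. }
  destruct (power_series_derivative e E HE) as (dE & HdE & Hder).
  assert (HdEE : forall z, inD z -> dE z = E z).
  { intros x Hx. apply Cseries_unique with (fun n => e n * x ^ n).
    - apply Cseries_ext with (2 := proj1 (Cpseries_series _ _ _) (HdE x Hx)).
      intro n. unfold e. rewrite <- RtoC_mult. f_equal. f_equal.
      assert (H1 := INR_fact_neq_0 n). assert (H2 : INR (S n) <> 0%R) by (apply not_0_INR; lia).
      rewrite fact_simpl, mult_INR. field. auto.
    - exact (proj1 (Cpseries_series _ _ _) (HE x Hx)). }
  assert (HC : forall x, inD x -> E x * cexp (- x) = E 0 * cexp (- 0)).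
  { apply (der_zero_const (fun x => E x * cexp (- x))). intros x Hx.
    assert (D1 := Hder x Hx). rewrite HdEE in D1 by auto.
    assert (D2 : der (fun y => - y) x (- (1))).
    { apply bigO_ext with (fun _ => 0); [intro; ring | apply bigO_zero]. }
    assert (D3 := der_comp cexp (fun y => - y) x _ _ D2 (der_cexp (- x))).
    assert (D4 := der_mult _ _ _ _ _ D1 D3). simpl in D4.
    replace (RtoC 0) with (E x * cexp (- x) + E x * (cexp (- x) * - (1))) by ring. exact D4. }
  intro Hz. replace (cexp z) with (E z); [apply HE; auto|].
  specialize (HC z Hz). rewrite (power_series_at_0 e E HE) in HC.
  replace (- 0) with (RtoC 0) in HC by ring. rewrite cexp_0 in HC.
  unfold e in HC. simpl in HC. rewrite Rinv_1 in HC.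
  replace (E z) with (E z * cexp (- z) * cexp z).
  - rewrite HC. ring.
  - rewrite <- Cmult_assoc, (Cmult_comm (cexp (- z))), cexp_inv. ring.
Qed.

Lemma cexp_jet_2 : bigO 3 (fun h => cexp h - (1 + h + RtoC (/ 2) * h ^ 2)).
Proof.
  apply bigO_ext with (fun h => cexp h - Csum (fun k => RtoC (/ INR (fact k)) * h ^ k) 2);
    [|apply (power_series_jet_0 _ _ cexp_power_series)].
  intro h. rewrite !Csum_S, Csum_0. simpl.
  replace (1 + 1)%R with 2%R by ring. rewrite Rinv_1. ring.
Qed.

Lemma cexp_jet_3 : bigO 4 (fun h => cexp h - (1 + h + RtoC (/ 2) * h ^ 2 + RtoC (/ 6) * h ^ 3)).
Proof.
  apply bigO_ext with (fun h => cexp h - Csum (fun k => RtoC (/ INR (fact k)) * h ^ k) 3);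
    [|apply (power_series_jet_0 _ _ cexp_power_series)].
  intro h. rewrite !Csum_S, Csum_0. simpl.
  replace (1 + 1 + 1 + 1 + 1 + 1)%R with 6%R by ring.
  replace (1 + 1)%R with 2%R by ring. rewrite Rinv_1. ring.
Qed.

(** * The coefficient bounds *)

(* The derivative (1 + w) e^w of w e^w does not vanish on the disk. *)
Lemma jet2_of_wexp (w : C -> C) (z : C) :
  inD (w z) -> bigO 1 (fun h => w (z + h) - w z) ->
  jet2 (fun x => w x * cexp (w x)) z -> jet2 w z.
Proof.
  intros Hw Hu (A & B & D & H).
  assert (EA : A = w z * cexp (w z)) by apply (bigO_jet2 (fun x => w x * cexp (w x)) z A B D H).
  subst A.
  set (u := fun h => w (z + h) - w z) in *.
  set (w0 := w z) in *. set (e0 := cexp w0) in *.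
  assert (He0 : e0 <> 0) by apply cexp_neq_0.
  set (k := 1 + w0).
  assert (Hk : k <> 0).
  { intro E. unfold inD in Hw. replace w0 with (k - 1) in Hw by (unfold k; ring).
    rewrite E in Hw. replace (0 - 1) with (- (1)) in Hw by ring. rewrite Cmod_m1 in Hw. lra. }
  (* For w = w0 + u one has w e^w / e0 = w0 + k u + mu u^2 + O(u^3). The coefficients [al] and [be]
     of u solve B = e0 k al and D = e0 (k be + mu al^2). *)
  set (mu := 1 + RtoC (/ 2) * w0).
  set (al := B / e0 / k). set (be := (D / e0 - mu * al ^ 2) / k).
  set (U := fun h => al * h + be * h ^ 2).
  exists w0, al, be.
  apply bigO_ext with (fun h => u h - U h); [intro h; unfold u, U; fold w0; ring|].
  assert (HU : bigO 1 U).
  { apply bigO_plus; apply bigO_scal; [apply bigO_id|].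
    apply bigO_le with 2%nat; [lia | apply bigO_pow_id]. }
  (* k u + mu u^2 minus the same expression in U factors as (u - U)(k + mu (u + U)). *)
  apply bigO_cancel with k (fun h => mu * (u h + U h)); auto.
  { apply bigO_scal, bigO_plus; auto. }
  assert (Hr := bigO_comp _ _ _ _ Nat.lt_0_1 cexp_jet_2 Hu). rewrite Nat.mul_1_l in Hr.
  apply bigO_ext with (fun h =>
    / e0 * (w (z + h) * cexp (w (z + h)) - (w0 * e0 + B * h + D * h ^ 2))
    - (w0 + u h) * (cexp (u h) - (1 + u h + RtoC (/ 2) * u h ^ 2))
    - RtoC (/ 2) * (u h * (u h * u h))
    - mu * (2 * al * be + be * be * h) * h ^ 3).
  { intro h. replace (w (z + h)) with (w0 + u h) by (unfold u; fold w0; ring).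
    rewrite cexp_plus. fold e0.
    assert (HB : B = al * k * e0) by (unfold al; field; auto).
    assert (HD : D = (be * k + mu * al ^ 2) * e0) by (unfold be; field; auto).
    clearbody al be. rewrite HB, HD. unfold U, mu, k.
    rewrite RtoC_inv by lra. field. auto. }
  assert (Hu0 : bigO 0 u) by (apply bigO_le with 1%nat; auto).
  clearbody u. repeat apply bigO_minus.
  - apply bigO_scal. exact H.
  - apply (bigO_mult 0 3); auto. bounded; auto.
  - apply bigO_scal. apply (bigO_mult 1 2); auto. apply (bigO_mult 1 1); auto.
  - apply (bigO_mult 0 3); [bounded | apply bigO_pow_id].
Qed.

(** f has a simple zero at 0, so |f h| >= |h|/2 nearby and division costs one order. At h = 0 the
    product carries no information, whence the condition on Y 0. *)
Lemma bigO_cancel_id (n : nat) (f Y : C -> C) :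
  bigO 2 (fun h => f h - h) -> Y 0 = 0 -> bigO (S n) (fun h => f h * Y h) -> bigO n Y.
Proof.
  intros Hf HY0 HY.
  destruct (bigO_elim _ _ Hf) as (K & d & HK & Hd & H).
  destruct (bigO_elim _ _ HY) as (K' & d' & HK' & Hd' & H').
  assert (Hd2 : (0 < / (2 * K))%R) by (apply Rinv_0_lt_compat; lra).
  apply bigO_intro with (2 * K')%R (Rmin (Rmin d d') (/ (2 * K))).
  { repeat apply Rmin_glb_lt; lra. }
  intros h Hh.
  destruct (Ceq_dec h 0) as [-> | Hh0].
  { rewrite HY0, Cmod_0. apply Rmult_le_pos; [lra | apply pow_le; lra]. }
  apply Cmod_gt_0 in Hh0.
  assert (M1 := Rmin_l (Rmin d d') (/ (2 * K))). assert (M2 := Rmin_r (Rmin d d') (/ (2 * K))).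
  assert (M3 := Rmin_l d d'). assert (M4 := Rmin_r d d').
  specialize (H h ltac:(lra)). specialize (H' h ltac:(lra)).
  assert (Hs : (K * Cmod h <= 1 / 2)%R).
  { apply Rle_trans with (K * / (2 * K))%R; [apply Rmult_le_compat_l; lra | right; field; lra]. }
  assert (T := Cmod_plus_ge h (f h - h)). replace (h + (f h - h)) with (f h) in T by ring.
  assert (Hfh : (Cmod h / 2 <= Cmod (f h))%R) by nra.
  rewrite Cmod_mult in H'. simpl in H'.
  assert (HYp := Cmod_ge_0 (Y h)).
  apply Rmult_le_reg_l with (Cmod h / 2)%R; [lra|].
  apply Rle_trans with (Cmod (f h) * Cmod (Y h))%R; [apply Rmult_le_compat_r; auto|].
  lra.
Qed.

Section Coefficients.

Variables (f w : C -> C) (b : nat -> C).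
Hypothesis Hf : forall z, inD z -> Cpseries b z (f z).
Hypothesis Hb0 : b 0%nat = 0.
Hypothesis Hb1 : b 1%nat = 1.
Variable df : C -> C.
Hypothesis Hdf : forall z, inD z -> Cpseries (fun n => INR (S n) * b (S n)) z (df z).
Hypothesis Hw1 : bigO 1 w.
Hypothesis Hode : forall z, inD z -> f z * (w z * cexp (w z)) = z * df z - f z.

Let c1 := b 2%nat.
Let c2 := 2 * b 3%nat - 2 * c1 ^ 2.
Let c3 := 3 * b 4%nat - RtoC (7 / 2) * c1 * c2 - RtoC (5 / 2) * c1 ^ 3.
Let c4 := 4 * b 5%nat - RtoC (10 / 3) * c1 * c3 - RtoC (3 / 2) * c2 ^ 2
  - RtoC (37 / 6) * c1 ^ 2 * c2 - RtoC (5 / 2) * c1 ^ 4.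

(* Both w and the polynomial W solve f (w e^w) = z f' - f up to O(z^6), so they agree
   up to O(z^5). *)
Lemma schwarz_expansion : bigO 5 (fun h => w h - poly4 c1 c2 c3 c4 h).
Proof.
  set (W := poly4 c1 c2 c3 c4).
  assert (HW1 : bigO 1 W) by apply bigO_poly4.
  set (P := fun h => h + b 2%nat * h ^ 2 + b 3%nat * h ^ 3 + b 4%nat * h ^ 4 + b 5%nat * h ^ 5).
  set (N := fun h => b 2%nat * h ^ 2 + 2 * b 3%nat * h ^ 3 + 3 * b 4%nat * h ^ 4 + 4 * b 5%nat * h ^ 5).
  assert (HP : bigO 6 (fun h => f h - P h)).
  { apply bigO_ext with (fun h => f h - Csum (fun k => b k * h ^ k) 5);
      [|apply (power_series_jet_0 b f Hf)].
    intro h. rewrite !Csum_S, Csum_0, Hb0, Hb1. unfold P; simpl. ring. }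
  assert (HP2 : bigO 2 (fun h => P h - h)).
  { apply bigO_ext with (fun h => (b 2%nat + b 3%nat * h + b 4%nat * (h * h) + b 5%nat * (h * (h * h))) * h ^ 2).
    { intro; unfold P; ring. }
    apply (bigO_mult 0 2); [bounded | apply bigO_pow_id]. }
  assert (Hf2 : bigO 2 (fun h => f h - h)).
  { apply bigO_ext with (fun h => (f h - P h) + (P h - h)); [intro; ring|].
    apply bigO_plus; auto. apply bigO_le with 6%nat; [lia | auto]. }
  assert (HN : bigO 6 (fun h => (h * df h - f h) - N h)).
  { assert (HD := power_series_jet_0 _ _ Hdf 4).
    apply bigO_ext with (fun h => h * (df h - Csum (fun k => INR (S k) * b (S k) * h ^ k) 4)
       - (f h - P h)).
    { intro h. rewrite !Csum_S, Csum_0, Hb1. unfold P, N. simpl INR.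
      rewrite !RtoC_plus. ring. }
    apply bigO_minus; auto. apply (bigO_mult 1 5); auto using bigO_id. }
  assert (Hf1 : bigO 1 f).
  { apply bigO_self with (fun h => h); auto using bigO_id. apply bigO_le with 2%nat; auto. }
  (* Taylor polynomial of v e^v of degree four. *)
  set (kap := fun v => v + v ^ 2 + RtoC (/ 2) * v ^ 3 + RtoC (/ 6) * v ^ 4).
  assert (Hkw : bigO 5 (fun h => w h * cexp (w h) - kap (w h))).
  { assert (Hr := bigO_comp _ _ _ _ Nat.lt_0_1 cexp_jet_3 Hw1). rewrite Nat.mul_1_l in Hr.
    eapply bigO_ext; [|apply (bigO_mult 1 4 _ _ Hw1 Hr)].
    intro h; unfold kap; simpl; ring. }
  assert (HkW : bigO 6 (fun h => f h * kap (W h) - N h)).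
  { destruct (poly4_powers c1 c2 c3 c4) as (H2 & H3 & H4). fold W in H2, H3, H4.
    (* Together with c1, the coefficients of kap (W h) up to degree four. *)
    set (h2 := c2 + c1 ^ 2). set (h3 := c3 + 2 * c1 * c2 + RtoC (/ 2) * c1 ^ 3).
    set (h4 := c4 + 2 * c1 * c3 + c2 ^ 2 + RtoC (3 / 2) * c1 ^ 2 * c2 + RtoC (/ 6) * c1 ^ 4).
    assert (HK : bigO 5 (fun h => kap (W h) - poly4 c1 h2 h3 h4 h)).
    { eapply bigO_ext; [|apply (bigO_plus _ _ _ H2 (bigO_plus _ _ _
        (bigO_scal _ (RtoC (/ 2)) _ H3) (bigO_scal _ (RtoC (/ 6)) _ H4)))].
      intro h. unfold kap, h2, h3, h4, W, poly4. rewrite (RtoC_div 3 2), !RtoC_inv by lra.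
      simpl. field. }
    (* The last summand collects the degrees from 6 on of the product of P with the expansion of kap
       (W h). Up to degree 5 that product is N, which is how c1, ..., c4 were chosen. *)
    apply bigO_ext with (fun h => f h * (kap (W h) - poly4 c1 h2 h3 h4 h)
      + poly4 c1 h2 h3 h4 h * (f h - P h)
      + (b 2%nat * h4 + b 3%nat * h3 + b 4%nat * h2 + b 5%nat * c1
         + h * (b 3%nat * h4 + b 4%nat * h3 + b 5%nat * h2)
         + h * h * (b 4%nat * h4 + b 5%nat * h3) + h * h * h * (b 5%nat * h4)) * h ^ 6).
    { intro h.
      assert (E2 : b 2%nat = c1) by reflexivity.
      assert (E3 : b 3%nat = RtoC (/ 2) * (c2 + 2 * c1 ^ 2)).
      { unfold c2. rewrite RtoC_inv by lra. field. }
      assert (E4 : b 4%nat = RtoC (/ 3) * (c3 + RtoC (7 / 2) * c1 * c2 + RtoC (5 / 2) * c1 ^ 3)).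
      { unfold c3. rewrite RtoC_inv by lra. field. }
      assert (E5 : b 5%nat = RtoC (/ 4) * (c4 + RtoC (10 / 3) * c1 * c3 + RtoC (3 / 2) * c2 ^ 2
         + RtoC (37 / 6) * c1 ^ 2 * c2 + RtoC (5 / 2) * c1 ^ 4)).
      { unfold c4. rewrite RtoC_inv by lra. field. }
      generalize (kap (W h)) (f h). intros kk ff.
      unfold N, P, poly4, h2, h3, h4. clearbody c4 c3 c2 c1.
      rewrite E2, E3, E4, E5.
      replace (RtoC (/ 6)) with (/ RtoC 6) by (rewrite RtoC_inv by lra; auto).
      replace (RtoC (10 / 3)) with (RtoC 10 / RtoC 3) by (rewrite RtoC_div by lra; auto).
      replace (RtoC (37 / 6)) with (RtoC 37 / RtoC 6) by (rewrite RtoC_div by lra; auto).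
      rewrite !RtoC_div, !RtoC_inv by lra. field. }
    apply bigO_plus; [apply bigO_plus|].
    - apply (bigO_mult 1 5); auto.
    - apply bigO_le with (1 + 6)%nat; [lia|]. apply bigO_mult; auto using bigO_poly4.
    - apply (bigO_mult 0 6); [bounded | apply bigO_pow_id]. }
  assert (Hw0 : w 0 = 0) by (apply bigO_at_zero with 1%nat; auto).
  assert (HW0 : W 0 = 0) by (apply bigO_at_zero with 1%nat; auto).
  (* Dividing by the simple zero of f lowers the order from 6 to 5, just enough for c4. *)
  assert (HY : bigO 5 (fun h => kap (w h) - kap (W h))).
  { apply bigO_cancel_id with f; auto.
    { rewrite Hw0, HW0. ring. }
    apply bigO_ext_loc with (fun h => ((h * df h - f h) - N h) - (f h * kap (W h) - N h)
      - f h * (w h * cexp (w h) - kap (w h))) 1%R; [lra | |].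
    { intros h Hh. rewrite <- (Hode h Hh). ring. }
    apply bigO_minus; [apply bigO_minus; auto|]. apply (bigO_mult 1 5); auto. }
  assert (Hwb : bigO 0 w) by (apply bigO_le with 1%nat; auto).
  assert (HWb : bigO 0 W) by (apply bigO_le with 1%nat; auto).
  clearbody W.
  (* kap (w) - kap (W) factors as w - W times 1 + O(h). *)
  apply bigO_cancel with (RtoC 1) (fun h => (w h + W h) +
     (RtoC (/ 2) * (w h * w h + w h * W h + W h * W h)
      + RtoC (/ 6) * ((w h + W h) * (w h * w h + W h * W h)))).
  - apply Cmod_gt_0; rewrite Cmod_1; lra.
  - repeat apply bigO_plus; auto; apply bigO_scal.
    + repeat apply bigO_plus; apply (bigO_mult 0 1); auto.
    + apply (bigO_mult 1 0); [apply bigO_plus; auto | bounded; auto].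
  - eapply bigO_ext; [|exact HY]. intro h. unfold kap; simpl. ring.
Qed.

End Coefficients.

Lemma coefficient_bounds (f : C -> C) (b : nat -> C) :
  Sstar_wp f -> b 0%nat = 0 -> b 1%nat = 1 ->
  (forall z, inD z -> Cpseries b z (f z)) ->
  (Cmod (b 2%nat) <= 1)%R /\ (Cmod (b 3%nat) <= 1)%R /\
  (Cmod (b 4%nat) <= 5 / 6)%R /\ (Cmod (b 5%nat) <= 5 / 8)%R.
Proof.
  intros ((Hfan & Hf0 & _) & Hfnz & w & Hwan & Hw0 & HwD & Hsub) Hb0 Hb1 Hf.
  destruct (power_series_derivative b f Hf) as (df & Hdf & Hder).
  (* Cleared of denominators, the subordination also holds at 0, where [logderiv] takes its
     removable value. *)
  assert (Hode : forall z, inD z -> f z * (w z * cexp (w z)) = z * df z - f z).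
  { intros z Hz. destruct (Ceq_dec z 0) as [-> | Hz0]; [rewrite Hf0; ring|].
    assert (E := Hsub z Hz). unfold logderiv, wp in E.
    destruct (Ceq_dec z 0) as [E0 | _]; [contradiction|].
    rewrite (der_Cderiv f z (df z) (Hder z Hz)) in E.
    assert (Hfz := Hfnz z Hz Hz0).
    replace (w z * cexp (w z)) with ((1 + w z * cexp (w z)) - 1) by ring.
    rewrite <- E. field. auto. }
  assert (Hwc : forall z, inD z -> bigO 1 (fun h => w (z + h) - w z)).
  { intros z Hz. destruct (Hwan z Hz) as [l Hl]. apply is_derive_bigO1 with l; auto. }
  assert (Hw1 : bigO 1 w).
  { apply bigO_ext with (fun h => w (0 + h) - w 0).
    - intro h. rewrite Hw0, Cplus_0_l. ring.
    - apply Hwc. unfold inD; rewrite Cmod_0; lra. }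
  assert (HJ : forall z, (0 < Cmod z < 1)%R -> jet2 w z).
  { intros z [Hz0 Hz]. apply Cmod_gt_0 in Hz0.
    apply jet2_of_wexp; [apply HwD; auto | apply Hwc; auto |].
    assert (Hd : (0 < 1 - Cmod z)%R) by lra.
    assert (Hfz := jet2_bigO1 _ _ (power_series_jet2 b f Hf z Hz)).
    assert (Hnz := Hfnz z Hz Hz0). assert (Hnz' := Hnz). apply Cmod_gt_0 in Hnz'.
    destruct (bigO_small 1 _ _ Nat.lt_0_1 Hfz Hnz') as (d & Hd1 & Hd2).
    (* Near a point other than 0, w e^w is the quotient (x f' - f)/f of functions given by power
       series, and f has no zero within distance d. *)
    apply jet2_ext_loc with (fun x => (x * df x + (- (1)) * f x) / f x) (Rmin d (1 - Cmod z))%R.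
    - apply Rmin_glb_lt; auto.
    - intros h Hh.
      assert (M1 := Rmin_l d (1 - Cmod z)). assert (M2 := Rmin_r d (1 - Cmod z)).
      assert (Hzh : inD (z + h)).
      { unfold inD. eapply Rle_lt_trans; [apply Cmod_triangle | lra]. }
      assert (Hn : f (z + h) <> 0).
      { intro E. specialize (Hd2 h ltac:(lra)). rewrite E in Hd2.
        replace (0 - f z) with (- f z) in Hd2 by ring. rewrite Cmod_opp in Hd2. lra. }
      replace ((z + h) * df (z + h) + (- (1)) * f (z + h))
        with ((z + h) * df (z + h) - f (z + h)) by ring.
      rewrite <- Hode by auto. field. auto.
    - assert (J1 := power_series_jet2 b f Hf z Hz).
      assert (J2 := power_series_jet2 _ df Hdf z Hz).
      apply jet2_div; auto. apply jet2_plus; [|apply jet2_scal; auto].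
      apply jet2_mult; auto using jet2_id. }
  assert (HS := schwarz_expansion f w b Hf Hb0 Hb1 df Hdf Hw1 Hode). simpl in HS.
  match type of HS with bigO 5 (fun h => w h - poly4 ?x1 ?x2 ?x3 ?x4 h) =>
    set (c1 := x1) in *; set (c2 := x2) in *; set (c3 := x3) in *; set (c4 := x4) in * end.
  assert (Hj : schwarz_jet w c1 c2 c3 c4).
  { split; auto. intros z Hz; split; auto. apply HwD, Hz. }
  assert (B1 := rogosinski_le w c1 c2 c3 c4 1 1 Hj Cmod_1).
  assert (B2 := functional2_le _ _ _ _ _ Hj).
  assert (B3 := functional3_le _ _ _ _ _ Hj).
  assert (B4 := functional4_le _ _ _ _ _ Hj).
  (* The three functionals equal 2 b3, 3 b4 and 4 b5; this divides out the factor. *)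
  assert (Hn : forall (n : R) (x y : C) (m : R), (0 < n)%R -> RtoC n * x = y ->
     (Cmod y <= m)%R -> (Cmod x <= m / n)%R).
  { intros n x y m Hn <- H. rewrite Cmod_mult, Cmod_R, Rabs_pos_eq in H by lra.
    apply Rmult_le_reg_l with n; auto. replace (n * (m / n))%R with m by (field; lra). auto. }
  split; [exact B1|]. split; [|split].
  - replace 1%R with (2 / 2)%R by field. apply Hn with (3 := B2); [lra|].
    unfold c2, c1. ring.
  - replace (5 / 6)%R with (5 / 2 / 3)%R by field. apply Hn with (3 := B3); [lra|].
    unfold c3, c2, c1. ring.
  - replace (5 / 8)%R with (5 / 2 / 4)%R by field. apply Hn with (3 := B4); [lra|].
    unfold c4, c3, c2, c1. ring.
Qed.

(** * The extremal function *)

Lemma Cseries_re_im (a : nat -> C) (l : C) :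
  Cseries a l <-> is_series (fun n => Re (a n)) (Re l) /\ is_series (fun n => Im (a n)) (Im l).
Proof.
  assert (ER : forall n, sum_n (fun k => Re (a k)) n = Re (Csum a n)).
  { induction n as [|n IH]; [rewrite sum_O, Csum_0; auto|].
    rewrite sum_Sn, Csum_S, IH. destruct (Csum a n), (a (S n)). reflexivity. }
  assert (EI : forall n, sum_n (fun k => Im (a k)) n = Im (Csum a n)).
  { induction n as [|n IH]; [rewrite sum_O, Csum_0; auto|].
    rewrite sum_Sn, Csum_S, IH. destruct (Csum a n), (a (S n)). reflexivity. }
  assert (L := fun P Q => filterlim_locally (U := C_UniformSpace) (F := eventually) P Q).
  assert (L1 := fun P Q => filterlim_locally (U := R_UniformSpace) (F := eventually) P Q).
  split.
  - intro H. assert (H' := proj1 (L _ _) H).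
    split; apply (proj2 (L1 _ _)); intro eps; destruct (H' eps) as [N HN];
    exists N; intros n Hn; destruct (HN n Hn) as [H1 H2].
    + rewrite ER. exact H1.
    + rewrite EI. exact H2.
  - intros [H1 H2]. apply (proj2 (L _ _)). intro eps.
    destruct (proj1 (L1 _ _) H1 eps) as [N1 K1], (proj1 (L1 _ _) H2 eps) as [N2 K2].
    exists (N1 + N2)%nat. intros n Hn. split.
    + specialize (K1 n ltac:(lia)). rewrite ER in K1. exact K1.
    + specialize (K2 n ltac:(lia)). rewrite EI in K2. exact K2.
Qed.

(** Four real Cauchy products, one for each pairing of real and imaginary parts; absolute
    convergence of the parts is inherited from that of the moduli. *)
Lemma Cseries_mult (a b : nat -> C) (la lb : C) :
  Cseries a la -> Cseries b lb ->
  ex_series (fun n => Cmod (a n)) -> ex_series (fun n => Cmod (b n)) ->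
  Cseries (fun n => Csum (fun k => a k * b (n - k)%nat) n) (la * lb).
Proof.
  intros Ha Hb Aa Ab. apply Cseries_re_im in Ha. apply Cseries_re_im in Hb.
  destruct Ha as [Ha1 Ha2], Hb as [Hb1 Hb2].
  assert (A1 : forall x : nat -> C, ex_series (fun n => Cmod (x n)) ->
    ex_series (fun n => Rabs (Re (x n))) /\ ex_series (fun n => Rabs (Im (x n)))).
  { intros x Hx. split; eapply (ex_series_le (V := R_CompleteNormedModule)); try exact Hx;
    intro n; unfold norm; simpl; unfold abs; simpl; rewrite Rabs_Rabsolu;
    [apply re_le_Cmod | apply im_le_Cmod]. }
  destruct (A1 a Aa) as [Aa1 Aa2], (A1 b Ab) as [Ab1 Ab2].
  assert (S11 := is_series_mult _ _ _ _ Ha1 Hb1 Aa1 Ab1).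
  assert (S22 := is_series_mult _ _ _ _ Ha2 Hb2 Aa2 Ab2).
  assert (S12 := is_series_mult _ _ _ _ Ha1 Hb2 Aa1 Ab2).
  assert (S21 := is_series_mult _ _ _ _ Ha2 Hb1 Aa2 Ab1).
  apply Cseries_re_im.
  assert (E : forall n, Csum (fun k => a k * b (n - k)%nat) n =
    (sum_f_R0 (fun k => Re (a k) * Re (b (n - k)%nat))%R n
     - sum_f_R0 (fun k => Im (a k) * Im (b (n - k)%nat))%R n,
     sum_f_R0 (fun k => Re (a k) * Im (b (n - k)%nat))%R n
     + sum_f_R0 (fun k => Im (a k) * Re (b (n - k)%nat))%R n)%R).
  { intro n.
    enough (E : forall m, Csum (fun k => a k * b (n - k)%nat) m =
    (sum_f_R0 (fun k => Re (a k) * Re (b (n - k)%nat))%R m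
     - sum_f_R0 (fun k => Im (a k) * Im (b (n - k)%nat))%R m,
     sum_f_R0 (fun k => Re (a k) * Im (b (n - k)%nat))%R m
     + sum_f_R0 (fun k => Im (a k) * Re (b (n - k)%nat))%R m)%R) by apply E.
    induction m as [|m IH].
    - rewrite Csum_0. reflexivity.
    - rewrite Csum_S, IH. simpl. apply injective_projections; simpl; unfold Re, Im; ring. }
  split.
  - apply is_series_ext with (2 := is_series_minus _ _ _ _ S11 S22).
    intro n. rewrite E. reflexivity.
  - apply is_series_ext with (2 := is_series_plus _ _ _ _ S12 S21).
    intro n. rewrite E. reflexivity.
Qed.

(* bell_table n k is the coefficient B_k / k! of e^(e^z - 1) for k <= n; it encodes the
   recursion (n + 1) beta_(n+1) = sum_(k <= n) beta_k / (n - k)!, i.e. F' = e^z F. *)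
Fixpoint bell_table (n k : nat) : R :=
  match n with
  | O => 1%R
  | S m => if Nat.leb k m then bell_table m k
           else (sum_f_R0 (fun j => bell_table m j * / INR (fact (m - j)))%R m / INR (S m))%R
  end.

(** The diagonal of the table: keeping all earlier values in row n makes the recursion on every
    previous coefficient structural. *)
Definition bell (n : nat) : R := bell_table n n.

Lemma bell_table_eq (n k : nat) : (k <= n)%nat -> bell_table n k = bell k.
Proof.
  intro H. induction H as [|n H IH]; [reflexivity|].
  simpl. apply Nat.leb_le in H. rewrite H. auto.
Qed.

Lemma bell_S (n : nat) :
  (INR (S n) * bell (S n) = sum_f_R0 (fun j => bell j * / INR (fact (n - j))) n)%R.
Proof.
  unfold bell at 1. cbn [bell_table].
  replace (Nat.leb (S n) n) with false by (symmetry; apply Nat.leb_gt; lia).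
  rewrite (sum_eq (fun j => bell_table n j * / INR (fact (n - j)))%R
    (fun j => bell j * / INR (fact (n - j)))%R).
  2:{ intros j Hj. rewrite bell_table_eq; auto. }
  assert (H : INR (S n) <> 0%R) by (apply not_0_INR; lia).
  field; auto.
Qed.

(** By the recursion each coefficient is a mean of n + 1 numbers between 0 and 1. This bound gives
    convergence on the whole disk. *)
Lemma bell_bounds (n : nat) : (0 <= bell n <= 1)%R.
Proof.
  induction n as [n IH] using (well_founded_induction lt_wf).
  destruct n as [|n]; [unfold bell; simpl; lra|].
  assert (Hn : (0 < INR (S n))%R) by (apply lt_0_INR; lia).
  assert (Hs : forall m, (m <= n)%nat ->
    (0 <= sum_f_R0 (fun j => bell j * / INR (fact (n - j))) m <= INR (S m))%R).
  { assert (Ht : forall m, (m <= n)%nat -> (0 <= bell m * / INR (fact (n - m)) <= 1)%R).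
    { intros m Hm. assert (H1 := IH m ltac:(lia)). assert (H2 := inv_fact_le_1 (n - m)). nra. }
    induction m as [|m IHm]; intro Hm.
    - simpl sum_f_R0. simpl INR. apply Ht; auto.
    - cbn [sum_f_R0]. rewrite (S_INR (S m)). assert (H1 := IHm ltac:(lia)).
      assert (H2 := Ht (S m) Hm). lra. }
  specialize (Hs n (le_n n)). rewrite <- bell_S in Hs.
  split; [|apply Rmult_le_reg_l with (INR (S n)); lra].
  apply Rmult_le_reg_l with (INR (S n)); lra.
Qed.

Lemma bell_values :
  (bell 0 = 1 /\ bell 1 = 1 /\ bell 2 = 1 /\ bell 3 = 5 / 6 /\ bell 4 = 5 / 8)%R.
Proof.
  assert (B0 : bell 0 = 1%R) by reflexivity.
  assert (H1 := bell_S 0). assert (H2 := bell_S 1). assert (H3 := bell_S 2). assert (H4 := bell_S 3).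
  simpl in H1, H2, H3, H4.
  assert (B1 : bell 1 = 1%R) by lra.
  rewrite B0, B1 in *. assert (B2 : bell 2 = 1%R) by lra.
  rewrite B2 in *. assert (B3 : bell 3 = (5 / 6)%R) by lra.
  rewrite B3 in *. repeat split; lra.
Qed.

Lemma Csum_RtoC (x : nat -> R) (n : nat) : Csum (fun k => RtoC (x k)) n = RtoC (sum_f_R0 x n).
Proof.
  induction n as [|n IH]; [rewrite Csum_0; auto|].
  rewrite Csum_S, IH, <- RtoC_plus. reflexivity.
Qed.

Lemma ex_series_Cmod_power (x : nat -> R) (z : C) :
  inD z -> (forall n, (0 <= x n <= 1)%R) -> ex_series (fun n => Cmod (RtoC (x n) * z ^ n)).
Proof.
  intros Hz Hx. unfold inD in Hz. assert (H0 := Cmod_ge_0 z).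
  apply (ex_series_le (V := R_CompleteNormedModule)) with (fun n => Cmod z ^ n)%R.
  - intro n. unfold norm; simpl; unfold abs; simpl.
    rewrite Rabs_pos_eq by apply Cmod_ge_0.
    rewrite Cmod_mult, Cmod_pow, Cmod_R. specialize (Hx n). rewrite Rabs_pos_eq by lra.
    assert (H2 := pow_le _ n H0). nra.
  - apply ex_series_geom. rewrite Rabs_pos_eq; lra.
Qed.

(** The recursion, read through the Cauchy product with the exponential series, gives F' = e^x F.
    Then F(x) exp(1 - e^x) has zero derivative and equals its value 1 at 0. *)
Lemma bell_power_series (z : C) :
  inD z -> Cpseries (fun n => RtoC (bell n)) z (cexp (cexp z - 1)).
Proof.
  destruct (ex_power_series (fun n => RtoC (bell n))) as [F HF].
  { intro n. assert (H := bell_bounds n). rewrite Cmod_R, Rabs_pos_eq; lra. }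
  destruct (power_series_derivative _ F HF) as (dF & HdF & Hder).
  assert (HdFE : forall x, inD x -> dF x = F x * cexp x).
  { intros x Hx. apply Cseries_unique with (fun n => INR (S n) * bell (S n) * x ^ n).
    - exact (proj1 (Cpseries_series _ _ _) (HdF x Hx)).
    - assert (HM := Cseries_mult _ _ _ _ (proj1 (Cpseries_series _ _ _) (HF x Hx))
        (proj1 (Cpseries_series _ _ _) (cexp_power_series x Hx))
        (ex_series_Cmod_power bell x Hx bell_bounds)
        (ex_series_Cmod_power (fun n => / INR (fact n))%R x Hx
          (fun n => conj (Rlt_le _ _ (proj1 (inv_fact_le_1 n))) (proj2 (inv_fact_le_1 n))))).
      apply Cseries_ext with (2 := HM). intro n.
      rewrite <- RtoC_mult, bell_S, <- Csum_RtoC, Cmult_comm, <- Csum_scal.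
      apply Csum_ext. intros k Hk. rewrite RtoC_mult.
      replace (x ^ n) with (x ^ k * x ^ (n - k)) by (rewrite <- Cpow_add_r; f_equal; lia).
      ring. }
  assert (HC : forall x, inD x -> F x * cexp (1 - cexp x) = F 0 * cexp (1 - cexp 0)).
  { apply (der_zero_const (fun x => F x * cexp (1 - cexp x))). intros x Hx.
    assert (D1 := Hder x Hx). rewrite HdFE in D1 by auto.
    assert (D2 : der (fun y => 1 - cexp y) x (- cexp x)).
    { eapply bigO_ext; [|apply (bigO_opp _ _ (der_cexp x))]. intro; simpl; ring. }
    assert (D3 := der_comp cexp (fun y => 1 - cexp y) x _ _ D2 (der_cexp (1 - cexp x))).
    assert (D4 := der_mult _ _ _ _ _ D1 D3). simpl in D4.
    replace (RtoC 0) with (F x * cexp x * cexp (1 - cexp x)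
      + F x * (cexp (1 - cexp x) * - cexp x)) by ring. exact D4. }
  intro Hz. replace (cexp (cexp z - 1)) with (F z); [apply HF; auto|].
  specialize (HC z Hz). rewrite (power_series_at_0 _ F HF), cexp_0 in HC.
  replace (1 - 1) with (RtoC 0) in HC by ring. rewrite cexp_0 in HC.
  destruct bell_values as [B0 _]. rewrite B0 in HC.
  assert (HI := cexp_inv (cexp z - 1)).
  replace (- (cexp z - 1)) with (1 - cexp z) in HI by ring.
  replace (F z) with (F z * (cexp (cexp z - 1) * cexp (1 - cexp z))) by (rewrite HI; ring).
  replace (F z * (cexp (cexp z - 1) * cexp (1 - cexp z)))
    with (F z * cexp (1 - cexp z) * cexp (cexp z - 1)) by ring.
  rewrite HC. ring.
Qed.

(** The factored form makes the quotient z f1'/f1 visibly equal to 1 + z e^z. *)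
Lemma der_extremal (z : C) :
  der (fun z => z * cexp (cexp z - 1)) z (cexp (cexp z - 1) * (1 + z * cexp z)).
Proof.
  assert (D2 : der (fun y => cexp y - 1) z (cexp z)).
  { eapply bigO_ext; [|apply (der_cexp z)]. intro; simpl; ring. }
  assert (D3 := der_comp cexp (fun y => cexp y - 1) z _ _ D2 (der_cexp (cexp z - 1))).
  assert (D4 := der_mult _ _ _ _ _ (der_id z) D3). simpl in D4.
  replace (cexp (cexp z - 1) * (1 + z * cexp z))
    with (1 * cexp (cexp z - 1) + z * (cexp (cexp z - 1) * cexp z)) by ring. exact D4.
Qed.

Lemma extremal_Sstar_wp : Sstar_wp (fun z => z * cexp (cexp z - 1)).
Proof.
  split; [split; [|split]|split].
  - intros z _. eexists. apply der_is_derive, der_extremal.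
  - ring.
  - assert (D := der_extremal 0). rewrite cexp_0 in D.
    replace (1 - 1) with (RtoC 0) in D by ring. rewrite cexp_0 in D.
    replace (1 * (1 + 0 * 1)) with (RtoC 1) in D by ring.
    apply der_is_derive. exact D.
  - intros z _ Hz. apply Cmult_neq_0; auto using cexp_neq_0.
  - exists (fun z => z). split; [|split; [|split]]; auto.
    + intros z _. eexists. apply der_is_derive, der_id.
    + intros z _. unfold logderiv, wp. destruct (Ceq_dec z 0) as [-> | Hz]; [ring|].
      rewrite (der_Cderiv _ _ _ (der_extremal z)). field.
      split; auto using cexp_neq_0.
Qed.

Definition extremal_coef (n : nat) : C := match n with O => 0 | S m => RtoC (bell m) end.

Lemma extremal_power_series (z : C) :
  inD z -> Cpseries extremal_coef z (z * cexp (cexp z - 1)).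
Proof.
  intro Hz. apply Cpseries_series.
  assert (H := Cseries_scal z _ _ (proj1 (Cpseries_series _ _ _) (bell_power_series z Hz))).
  apply (is_series_decr_1 (V := C_NormedModule)).
  apply Cseries_ext with (fun n => z * (RtoC (bell n) * z ^ n)); [intro; simpl; ring|].
  apply (eq_ind _ (fun l : C => Cseries (fun n => z * (RtoC (bell n) * z ^ n)) l) H
    (z * cexp (cexp z - 1) + - (0 * 1))). ring.
Qed.

Theorem mainTheorem15 :
  (forall (f : C -> C) (b : nat -> C),
      Sstar_wp f ->
      b 0%nat = 0 -> b 1%nat = 1 ->
      (forall z, inD z -> @is_pseries C_AbsRing C_NormedModule b z (f z)) ->
      (Cmod (b 2%nat) <= 1)%R /\ (Cmod (b 3%nat) <= 1)%R /\
      (Cmod (b 4%nat) <= 5 / 6)%R /\ (Cmod (b 5%nat) <= 5 / 8)%R)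
  /\
  (let f1 := fun z : C => z * cexp (cexp z - 1) in
   Sstar_wp f1 /\
   exists b : nat -> C,
     (forall z, inD z -> @is_pseries C_AbsRing C_NormedModule b z (f1 z)) /\
     b 0%nat = 0 /\ b 1%nat = 1 /\
     b 2%nat = 1 /\ b 3%nat = 1 /\
     b 4%nat = RtoC (5 / 6) /\ b 5%nat = RtoC (5 / 8)).
Proof.
  split; [exact coefficient_bounds|].
  split; [exact extremal_Sstar_wp|].
  destruct bell_values as (B0 & B1 & B2 & B3 & B4).
  exists extremal_coef. unfold extremal_coef. rewrite B0, B1, B2, B3, B4.
  split; [exact extremal_power_series|]. auto 10.
Qed.
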